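(* Let $\mathcal{N}(t)$, $t>0$, be a classical nonlinear pure birth process with birth rates $\lambda_k>0$, $k\ge1$, and $\mathcal{N}(0)=1$, and let $T_t$ be the first-passage time at level $t$ of a standard Brownian motion independent of $\mathcal{N}$. Let $\hat p_k(t)=\Pr\{\mathcal{N}(T_t)=k\}$, $t>0$, $k\ge1$. Then the state probabilities satisfy the difference-differential equations $$\frac{d^2}{dt^2}\hat p_k(t)=2\left[\lambda_k\hat p_k(t)-\lambda_{k-1}\hat p_{k-1}(t)\right],\qquad k\ge1,\ t>0,$$ where $\hat p_0\equiv0$.
   Context: The nonlinear pure birth process $\mathcal{N}(t)$ with rates $(\lambda_k)_{k\ge1}$ is the continuous-time Markov chain on $\{1,2,\dots\}$ started at $1$ which from state $k$ jumps only to $k+1$, at rate $\lambda_k$; it is assumed throughout that $\sum_k1/\lambda_k=\infty$ (no explosion). For a standard Brownian motion $B$, $T_t=\inf\{s:B(s)=t\}$, with density $q(t,s)=t\,e^{-t^2/(2s)}/\sqrt{2\pi s^3}$, $s>0$. *)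

(* Defs.v *)
From HB Require Import structures.
From mathcomp Require Import all_boot all_order all_algebra.
From mathcomp Require Import all_classical all_reals all_analysis.
Set Implicit Arguments.
Unset Strict Implicit.
Unset Printing Implicit Defensive.
Import Order.TTheory GRing.Theory Num.Theory.
Import numFieldNormedType.Exports.
Local Open Scope classical_set_scope.
Local Open Scope ring_scope.

(* Stochastic processes are functions X : R -> T -> U of time and outcome;
   only their values at times t >= 0 are ever constrained or used. *)

(* the sigma-algebra sigma(X_s : s in I) on the sample space *)
Definition process_salgebra (R : realType) (d : measure_display)
    (T : measurableType d) (d' : measure_display) (U : measurableType d')
    (X : R -> T -> U) (I : set R) : set_system T :=
  <<s \bigcup_(s in I) preimage_set_system setT (X s) measurable >>.

Definition independent_systems (R : realType) (d : measure_display)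
    (T : measurableType d) (P : probability T R) (F G : set_system T) : Prop :=
  forall A C : set T, F A -> G C -> P (A `&` C) = (P A * P C)%E.

Definition independent_processes (R : realType) (d : measure_display)
    (T : measurableType d) (P : probability T R)
    (d1 d2 : measure_display) (U1 : measurableType d1)
    (U2 : measurableType d2) (X : R -> T -> U1) (Y : R -> T -> U2) : Prop :=
  independent_systems P (process_salgebra X [set s | 0 <= s])
                        (process_salgebra Y [set s | 0 <= s]).

Record brownian_motion (R : realType) (d : measure_display)
    (T : measurableType d) (P : probability T R) (B : R -> T -> R) : Prop :=
  BrownianMotion {
    bm_measurable : forall t, 0 <= t -> measurable_fun setT (B t);
    bm_start : forall w, B 0 w = 0;
    bm_continuous : forall w, {within [set t | 0 <= t], continuous (B ^~ w)};
    bm_independent_increments : forall s t, 0 <= s -> s <= t ->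
      independent_systems P (process_salgebra B [set u | 0 <= u <= s])
        (preimage_set_system setT (fun w => B t w - B s w) measurable);
    (* the second parameter of normal_prob is the standard deviation *)
    bm_normal_increments : forall s t, 0 <= s -> s < t ->
      forall Y : set R, measurable Y ->
      P ((fun w => B t w - B s w) @^-1` Y)
      = normal_prob 0 (Num.sqrt (t - s)) Y }.

(* equals +oo if the level is never reached *)
Definition first_passage_time (R : realType) (T : Type) (B : R -> T -> R)
    (a : R) (w : T) : \bar R :=
  ereal_inf [set s%:E | s in [set s : R | 0 <= s /\ B s w = a]].

(* The state space of the chains below is {1, 2, ...}; values of transition
   functions and rates at the index 0 are irrelevant. *)

Record transition_function (R : realType) (p : nat -> nat -> R -> R) : Prop :=
  TransitionFunction {
    tf_ge0 : forall i j h, (1 <= i)%N -> (1 <= j)%N -> 0 <= h -> 0 <= p i j h;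
    tf_sum1 : forall i h, (1 <= i)%N -> 0 <= h ->
      (\sum_(1 <= j <oo) (p i j h)%:E = 1)%E;
    tf_id : forall i j, (1 <= i)%N -> (1 <= j)%N -> p i j 0 = (i == j)%:R;
    tf_chapman_kolmogorov : forall i k s t, (1 <= i)%N -> (1 <= k)%N ->
      0 <= s -> 0 <= t ->
      ((p i k (s + t))%:E = \sum_(1 <= j <oo) (p i j s * p j k t)%:E)%E }.

Definition birth_generator (R : realType) (lambda : nat -> R) (i j : nat) : R :=
  if j == i then - lambda i else if j == i.+1 then lambda i else 0.

(* The (time-homogeneous) Markov chain with generator birth_generator lambda
   started at 1, in its version whose paths are right-continuous step
   functions with only jumps from k to k+1. *)
Record pure_birth_process (R : realType) (d : measure_display)
    (T : measurableType d) (P : probability T R) (lambda : nat -> R)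
    (N : R -> T -> nat) : Prop :=
  PureBirthProcess {
    pb_measurable : forall t, 0 <= t -> measurable_fun setT (N t);
    pb_start : forall w, N 0 w = 1%N;
    pb_nondecreasing : forall w s t, 0 <= s -> s <= t -> (N s w <= N t w)%N;
    pb_right_continuous : forall w t, 0 <= t ->
      \forall s \near t^'+, N s w = N t w;
    pb_unit_jumps : forall w t, 0 < t ->
      \forall s \near t^'-, N t w = N s w \/ N t w = (N s w).+1;
    pb_markov : exists p : nat -> nat -> R -> R,
      [/\ transition_function p,
          forall t h A i j, 0 <= t -> 0 <= h ->
            process_salgebra N [set u | 0 <= u <= t] A ->
            (1 <= i)%N -> (1 <= j)%N ->
            P (A `&` [set w | N t w = i] `&` [set w | N (t + h) w = j])
            = (P (A `&` [set w | N t w = i]) * (p i j h)%:E)%E &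
          forall i j, (1 <= i)%N -> (1 <= j)%N ->
            (p i j h - (i == j)%:R) / h @[h --> 0^'+]
              --> birth_generator lambda i j] }.

(* Pr {N (T_t) = k} for k >= 1, with the convention that it is 0 for k = 0.
   The event requires T_t to be finite. *)
Definition hat_p (R : realType) (d : measure_display) (T : measurableType d)
    (P : probability T R) (N : R -> T -> nat) (B : R -> T -> R)
    (k : nat) (t : R) : R :=
  if k is 0%N then 0 else
  fine (P [set w | exists2 s : R, first_passage_time B t w = s%:E & N s w = k]).

(* Main.v *)
Require Import Defs.
From mathcomp Require Import all_boot all_order all_algebra.
From mathcomp Require Import all_classical all_reals all_analysis.
From mathcomp Require Import measurable_realfun ring lra.
Set Implicit Arguments.
Unset Strict Implicit.
Unset Printing Implicit Defensive.
Import Order.TTheory GRing.Theory Num.Theory.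
Import numFieldNormedType.Exports.
Local Open Scope classical_set_scope.
Local Open Scope ring_scope.

(* By the reflection principle P(T_t <= s) = 2 P(B_s >= t), so T_t has the law
   of 1/v^2 where v is a centred Gaussian of standard deviation 1/t.  Hence
   hat_p_k(t) is, up to a constant, the integral over v > 0 of
   p_k(1/v^2) t exp(-t^2 v^2/2), where p_k(s) = P(N_s = k).  Differentiating
   twice under the integral sign and integrating by parts in v, using
   d^2/dt^2 [t exp(-t^2 v^2/2)] = d/dv [- t v^3 exp(-t^2 v^2/2)],
   turns the second derivative of hat_p_k into -2 E[p_k'(T_t)], and the forward
   equation p_k' = lambda_(k-1) p_(k-1) - lambda_k p_k concludes.  This
   parametrization by v avoids any integrability condition on p_k. *)

(** * Gaussian moments *)

Section gaussian_kernel.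
Context {R : realType}.
Local Notation mu := (@lebesgue_measure R).
Implicit Types (a t v : R) (m : nat) (G : R -> R).

(** The law of [N] at T_t is computed without disintegration. T_t is rounded up to a grid, where
    independence is applied to countably many pairs of events and gives a series over grid cells.
    Right-continuity of the paths of [N] brings the rounded events back to the true one as the mesh
    shrinks. A modulus of continuity of p_k that is uniform over all times turns the series into the
    integral, although T_t is unbounded. The same rounding replaces the strong Markov property in
    the reflection principle: it bounds from below, by half of P(T_t <= s), the probabilities of two
    complementary parts of that event, and their sum forces equality. The forward equation comes
    from the generator because paths never decrease: only states up to k feed into p_k, so every
    limit is taken in a finite sum. Since p_k is only known to be bounded, the boundary terms of the
    integration by parts are controlled by the factor v^3 at 0 and by Gaussian decay at infinity. *)

Definition gauss_kernel t v : R := expR (- (t ^+ 2 * v ^+ 2 / 2)).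

Lemma gauss_kernel_gt0 t v : 0 < gauss_kernel t v.
Proof. exact: expR_gt0. Qed.

Lemma gauss_kernel_le1 t v : gauss_kernel t v <= 1.
Proof.
by rewrite -[leRHS]expR0 ler_expR oppr_le0 divr_ge0// mulr_ge0 ?sqr_ge0.
Qed.

Lemma normal_pdf_gauss_kernel t v : 0 < t ->
  normal_pdf 0 t^-1 v = t * normal_peak 1 * gauss_kernel t v.
Proof.
move=> t0; rewrite normal_pdfE ?invr_neq0 ?gt_eqF// /normal_fun subr0.
congr (_ * _); last first.
  by rewrite /gauss_kernel; congr expR; field; rewrite gt_eqF.
rewrite /normal_peak expr1n mul1r exprVn -mulrnAr sqrtrM ?invr_ge0 ?sqr_ge0//.
by rewrite sqrtrV ?sqr_ge0// sqrtr_sqr gtr0_norm// invfM invrK.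
Qed.

Lemma continuous_gauss_kernel t : continuous (gauss_kernel t).
Proof.
move=> v; apply: (cvg_comp _ expR); last exact: continuous_expR.
apply: (@cvgN _ R^o); apply: cvgM; last exact: cvg_cst.
by apply: cvgM; [exact: cvg_cst|exact: sqr_continuous].
Qed.

Lemma integrable_gauss_kernel t : 0 < t ->
  mu.-integrable setT (EFin \o gauss_kernel t).
Proof.
move=> t0; have c0 : t * normal_peak 1 != 0 :> R.
  by rewrite mulf_neq0 ?gt_eqF// normal_peak_gt0// oner_neq0.
rewrite (_ : _ \o _ = fun v => (t * normal_peak 1)^-1%:E *
    (normal_pdf 0 t^-1 v)%:E)%E; last first.
  by apply/funext => v /=; rewrite -EFinM normal_pdf_gauss_kernel// mulKf.
by apply: integrableZl => //; exact: integrable_normal_pdf.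
Qed.

(** With y = c x / (m+1), from y <= e^y and 1 <= e^y one gets y^m <= e^((m+1) y) = e^(c x). Dividing
    by m+1 rather than m also covers m = 0. *)
Lemma exprn_le_expR m (c : R) : 0 < c ->
  exists2 C, 0 <= C & forall x, 0 <= x -> x ^+ m <= C * expR (c * x).
Proof.
move=> c0; have d0 : 0 < m.+1%:R / c by rewrite divr_gt0.
exists ((m.+1%:R / c) ^+ m) => [|x x0]; first by rewrite exprn_ge0// ltW.
pose y := c * x / m.+1%:R.
have y0 : 0 <= y by rewrite divr_ge0// mulr_ge0// ltW.
have -> : x = m.+1%:R / c * y.
  by rewrite /y [RHS]mulrC mulrA divfK ?pnatr_eq0// mulrAC divff ?gt_eqF// mul1r.
rewrite exprMn; apply: ler_wpM2l; first by rewrite exprn_ge0// ltW.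
have -> : c * (m.+1%:R / c * y) = m%:R * y + y.
  by rewrite -natr1; field; rewrite gt_eqF.
rewrite expRD expRM_natl.
have y1 : y <= expR y by apply: le_trans (expR_ge1Dx y); rewrite lerDr.
rewrite -[leLHS]mulr1 ler_pM ?exprn_ge0//.
  by apply: lerXn2r; rewrite ?nnegrE ?expR_ge0.
by rewrite -[leLHS]expR0 ler_expR.
Qed.

(** The power is paid for with e^(a^2 v^2 / 4), half of the decay available at t = a; what remains
    is at most e^(-a^2 v^2 / 4), below [gauss_kernel (a / 2) v]. Uniformity over t >= a makes this a
    dominating function for differentiation in t. *)
Lemma gauss_moment_bound m a : 0 < a ->
  exists2 C, 0 <= C & forall t v, a <= t ->
    v ^+ m.*2 * gauss_kernel t v <= C * gauss_kernel (a / 2) v.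
Proof.
move=> a0; have a4 : 0 < a ^+ 2 / 4 by rewrite divr_gt0// exprn_gt0.
have [C C0 HC] := exprn_le_expR m a4; exists C => // t v at_.
rewrite -mul2n exprM; apply: (@le_trans _ _
   (C * expR (a ^+ 2 / 4 * v ^+ 2) * gauss_kernel t v)).
  by rewrite ler_wpM2r ?HC ?sqr_ge0// ltW// gauss_kernel_gt0.
rewrite -mulrA ler_wpM2l// -expRD ler_expR.
have : a ^+ 2 <= t ^+ 2 by apply: lerXn2r; rewrite ?nnegrE; lra.
have := sqr_ge0 v; have := sqr_ge0 a; nra.
Qed.

End gaussian_kernel.

Section gaussian_moments.
Context {R : realType}.
Local Notation mu := (@lebesgue_measure R).
Local Notation D := (`]0, +oo[%classic : set R).
Variables (G : R -> R) (M : R).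
Hypotheses (mG : measurable_fun D G) (G_le : forall v, D v -> `|G v| <= M).
Implicit Types (a t v : R) (m : nat).

(** Only even powers occur, since each derivative in t of the kernel brings down - t v^2. *)
Definition gauss_moment m t : R :=
  \int[mu]_(v in D) (G v * (v ^+ m.*2 * gauss_kernel t v)).

Lemma gauss_moment_integrand_bound m a : 0 < a ->
  exists2 C, 0 <= C & forall t v, a <= t -> D v ->
    `|G v * (v ^+ m.*2 * gauss_kernel t v)| <= C * gauss_kernel (a / 2) v.
Proof.
move=> a0; have [C C0 HC] := gauss_moment_bound m a0.
have M0 : 0 <= M by apply: le_trans (@G_le 1 _) => //=; rewrite in_itv/= ltr01.
exists (M * C) => [|t v at_ Dv]; first exact: mulr_ge0.
rewrite normrM -mulrA ler_pM ?G_le//.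
rewrite ger0_norm ?HC// mulr_ge0 ?(ltW (gauss_kernel_gt0 _ _))//.
by rewrite -mul2n exprM exprn_ge0 ?sqr_ge0.
Qed.

Lemma integrable_gauss_kernelZ a (C : R) : 0 < a ->
  mu.-integrable D (EFin \o (fun v => C * gauss_kernel a v)).
Proof.
move=> a0; rewrite (_ : _ \o _ = fun v => C%:E * (gauss_kernel a v)%:E)%E//.
apply: integrableZl => //; apply: (integrableS measurableT) => //.
exact: integrable_gauss_kernel.
Qed.

Lemma measurable_gauss_moment_integrand m t :
  measurable_fun D (fun v => G v * (v ^+ m.*2 * gauss_kernel t v)).
Proof.
apply: measurable_funM => //; apply: measurable_funTS.
apply: measurable_funM; first exact: measurable_funX.
by apply: continuous_measurable_fun; exact: continuous_gauss_kernel.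
Qed.

Lemma integrable_gauss_moment m t : 0 < t ->
  mu.-integrable D (EFin \o (fun v => G v * (v ^+ m.*2 * gauss_kernel t v))).
Proof.
move=> t0; have [C C0 HC] := gauss_moment_integrand_bound m t0.
have t2 : 0 < t / 2 by rewrite divr_gt0.
apply: le_integrable (integrable_gauss_kernelZ C t2) => //.
  by apply/measurable_EFinP; exact: measurable_gauss_moment_integrand.
move=> v Dv /=; rewrite lee_fin (le_trans (HC t v _ Dv))//.
exact: ler_norm.
Qed.

Lemma is_derive_gauss_kernel t v :
  is_derive t 1 (gauss_kernel ^~ v) (- (t * v ^+ 2 * gauss_kernel t v)).
Proof.
rewrite /gauss_kernel; apply: is_derive_eq.
by rewrite /GRing.scale /=; field.
Qed.

Lemma is_derive_gauss_kernelr t v :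
  is_derive v 1 (gauss_kernel t) (- (t ^+ 2 * v * gauss_kernel t v)).
Proof.
rewrite /gauss_kernel; apply: is_derive_eq.
by rewrite /GRing.scale /=; field.
Qed.

Lemma is_derive_gauss_moment m t : 0 < t ->
  is_derive t 1 (gauss_moment m) (- t * gauss_moment m.+1 t).
Proof.
move=> t0; pose f s v := G v * (v ^+ m.*2 * gauss_kernel s v).
have df (s v : R) : is_derive s 1 (f ^~ v : R -> R)
    (- s * (G v * (v ^+ m.+1.*2 * gauss_kernel s v))).
  rewrite /f; have dk := is_derive_gauss_kernel s v; apply: is_derive_eq.
  by rewrite /GRing.scale /= doubleS !exprS; ring.
have d1f (s v : R) : partial1of2 f s v =
    - s * (G v * (v ^+ m.+1.*2 * gauss_kernel s v)).
  by rewrite partial1of2E derive_val.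
have t2 : 0 < t / 2 by rewrite divr_gt0.
have [C C0 HC] := gauss_moment_integrand_bound m.+1 t2.
have tI : `]t / 2, t * 2[%classic t by rewrite /= in_itv/=; apply/andP; split; lra.
have gt0 s : `]t / 2, t * 2[%classic s -> 0 < s.
  by rewrite /= in_itv/= => /andP[+ _]; exact: lt_trans.
have if_ s : `]t / 2, t * 2[%classic s -> mu.-integrable D (EFin \o f s).
  by move=> /gt0; exact: integrable_gauss_moment.
have derf s v : `]t / 2, t * 2[%classic s -> D v -> derivable (f ^~ v) s 1.
  by move=> _ _; exact: ex_derive.
(* On the window the factor s of the derivative is below t * 2, and the moment bound with a = t / 2
   controls the rest, hence the kernel at t / 2 / 2. *)
pose g v := t * 2 * C * gauss_kernel (t / 2 / 2) v.
have g0 v : 0 <= g v.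
  by rewrite !mulr_ge0 ?(ltW t0) ?(ltW (gauss_kernel_gt0 _ _)).
have ig : mu.-integrable D (EFin \o g).
  by apply: integrable_gauss_kernelZ; rewrite divr_gt0.
have fg s v : `]t / 2, t * 2[%classic s -> D v -> `|partial1of2 f s v| <= g v.
  move=> Is Dv; rewrite d1f normrM normrN (gtr0_norm (gt0 _ Is)) /g -[leRHS]mulrA.
  have := Is; rewrite /= in_itv/= => /andP[ts st].
  by apply: ler_pM => //; [exact/ltW/gt0|exact: ltW|apply: HC => //; exact: ltW].
have Dm : measurable (D : set (measurableTypeR R)) by [].
have dm : derivable (gauss_moment m) t 1.
  exact: (derivable_under_integral Dm tI if_ derf g0 ig fg).
apply: DeriveDef => //.
rewrite -derive1E [LHS](differentiation_under_integral Dm tI if_ derf g0 ig fg).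
under eq_Rintegral do rewrite d1f.
by rewrite RintegralZl//; exact: integrable_gauss_moment.
Qed.

End gaussian_moments.

(** * Integration by parts and the second derivative *)

Section second_derivative.
Context {R : realType}.
Local Notation mu := (@lebesgue_measure R).
Local Notation D := (`]0, +oo[%classic : set R).
Implicit Types (a b t v : R).

(** Compact intervals away from 0 are where the fundamental theorem of calculus is applied below.
    The upper end [n.+2] keeps the endpoints in strict order even for n = 0. *)
Lemma cvg_integral_exhaust_itv0y (f : R -> R) :
  mu.-integrable D (EFin \o f) ->
  (\int[mu]_(v in `[(n.+1%:R^-1)%R, n.+2%:R%R]) (f v)%:E)%E @[n --> \oo] -->
  (\int[mu]_(v in D) (f v)%:E)%E.
Proof.
move=> iF; pose A n := `[n.+1%:R^-1, n.+2%:R]%classic : set R.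
have AD n : A n = D `&` A n.
  apply/esym/setIidPr => v; rewrite /A /= !in_itv/= andbT => /andP[+ _].
  by apply: lt_le_trans; rewrite invr_gt0.
rewrite [X in X @ _ --> _](_ : _ = fun n =>
    \int[mu]_(v in D) (((EFin \o f) \_ (A n)) v))%E; last first.
  by apply/funext => n; rewrite -integral_mkcondr -AD.
have mf := measurable_int _ iF.
have nf : mu.-integrable D (fun x => `|(EFin \o f) x|)%E.
  exact: (integrable_abse iF).
apply: (dominated_cvg _ _ _ _ nf) => //.
- move=> n; apply/(measurable_restrict _ _ _) => //; first exact: measurable_itv.
  by apply: measurable_funS mf => //; apply: subIsetl.
- move=> v Dv; apply: cvg_near_cst.
  move: Dv; rewrite /= in_itv/= andbT => v0.
  near=> n; rewrite patchE mem_set// /A /= in_itv/=; apply/andP; split.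
    apply: ltW.
    by near: n; exact: (near_infty_natSinv_lt (PosNum v0)).
  rewrite (@le_trans _ _ n%:R) ?ler_nat//; last by rewrite ltnW.
  by near: n; exact: nbhs_infty_ger.
- by move=> n v Dv; rewrite patchE; case: ifP => // _; rewrite abse0.
Unshelve. all: end_near. Qed.

Variables (G H : R -> R) (M : R).
Hypotheses (mG : measurable_fun D G) (G_le : forall v, D v -> `|G v| <= M).
Hypothesis G'E : forall v, 0 < v -> is_derive v 1 G (H v / v ^+ 3).
Hypotheses (cH : {in D, continuous H}) (H_le : forall v, D v -> `|H v| <= M).

Let mH : measurable_fun D H.
Proof. exact: open_continuous_measurable_fun. Qed.

(** The derivative of [G] may blow up like v^-3 at 0, as it does for a function of v^-2; the factor
    v^3 in [F] cancels exactly this, so that F' = f. The identity says that f has integral 0, that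
    is, that both boundary values of [F] vanish. *)
Lemma gauss_moment_by_parts t : 0 < t ->
  gauss_moment H 0 t = t ^+ 2 * gauss_moment G 2 t - 3 * gauss_moment G 1 t.
Proof.
move=> t0.
pose F v := G v * (v ^+ 3 * gauss_kernel t v).
pose f v := H v * (v ^+ 0.*2 * gauss_kernel t v)
  + (3 * (G v * (v ^+ 1.*2 * gauss_kernel t v))
   - t ^+ 2 * (G v * (v ^+ 2.*2 * gauss_kernel t v))).
have i0 := integrable_gauss_moment mH H_le 0 t0.
have i1 := integrable_gauss_moment mG G_le 1 t0.
have i2 := integrable_gauss_moment mG G_le 2 t0.
have i1' : mu.-integrable D
    (EFin \o (fun v => 3 * (G v * (v ^+ 1.*2 * gauss_kernel t v)))).
  by apply: (integrableZl _ 3 i1).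
have i2' : mu.-integrable D
    (EFin \o (fun v => t ^+ 2 * (G v * (v ^+ 2.*2 * gauss_kernel t v)))).
  by apply: (integrableZl _ (t ^+ 2) i2).
have mD : measurable (D : set (measurableTypeR R)) by [].
have i12 := integrableB mD i1' i2'.
have if_ : mu.-integrable D (EFin \o f).
  exact: (integrableD mD i0 i12).
suff : \int[mu]_(v in D) f v = 0.
  rewrite RintegralD// RintegralB// !RintegralZl// /gauss_moment => /eqP.
  by rewrite addr_eq0 opprB => /eqP.
have F_le v : 0 < v -> `|F v| <= M * v ^+ 3.
  move=> v0; rewrite normrM ler_pM ?G_le ?/= ?in_itv/= ?v0//.
  rewrite ger0_norm ?mulr_ge0 ?exprn_ge0 ?(ltW v0) ?(ltW (gauss_kernel_gt0 _ _))//.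
  by rewrite ler_piMr ?exprn_ge0 ?(ltW v0) ?gauss_kernel_le1.
have dF v : 0 < v -> is_derive v 1 F (f v).
  move=> v0; have dG := G'E v0; have dK := is_derive_gauss_kernelr t v.
  rewrite /F; apply: is_derive_eq.
  rewrite /GRing.scale /= /f /=; field; rewrite ?gt_eqF//.
have cf : {in D, continuous f}.
  move=> v Dv; have v0 : 0 < v by move: Dv; rewrite inE/= in_itv/= andbT.
  have cG : {for v, continuous G}.
    by apply: differentiable_continuous; apply/derivable1_diffP; have [] := G'E v0.
  have ck n : {for v, continuous (fun v => v ^+ n * gauss_kernel t v)}.
    by apply: cvgM; [exact: exprn_continuous|exact: continuous_gauss_kernel].
  have cHv := cH Dv.
  apply: cvgD; first by apply: cvgM => //; exact: ck.
  by apply: cvgB; apply: cvgM; try exact: cvg_cst; apply: cvgM => //; exact: ck.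
(* Decay at infinity: v F(v) is the integrand of the moment of order 2, which is bounded. *)
have [C C0 HC] := gauss_moment_integrand_bound G_le 2 t0.
have F_le2 v : 0 < v -> `|F v| <= C / v.
  move=> v0; rewrite ler_pdivlMr// -{2}(gtr0_norm v0) -normrM.
  rewrite (_ : F v * v = G v * (v ^+ 2.*2 * gauss_kernel t v)); last first.
    by rewrite /F; ring.
  rewrite (le_trans (HC t v _ _)) ?/= ?in_itv/= ?v0// ler_piMr//.
  exact: gauss_kernel_le1.
have FTC n : (\int[mu]_(v in `[(n.+1%:R^-1)%R, n.+2%:R%R]) (f v)%:E)%E =
    (F n.+2%:R - F n.+1%:R^-1)%:E.
  have subD v : n.+1%:R^-1 <= v -> 0 < v by apply: lt_le_trans; rewrite invr_gt0.
  have cF v : 0 < v -> {for v, continuous F}.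
    move=> v0; apply: differentiable_continuous; apply/derivable1_diffP.
    by have [] := dF v v0.
  have ab : n.+1%:R^-1 < n.+2%:R :> R.
    by rewrite (@le_lt_trans _ _ 1) ?invf_le1 ?ler1n ?ltr1n.
  rewrite (continuous_FTC2 ab (f := f) (F := F)) ?EFinB//.
  - apply: continuous_in_subspaceT => v; rewrite inE/= in_itv/= => /andP[v1 _].
    by apply: cf; rewrite inE/= in_itv/= subD.
  - split.
    + move=> v; rewrite in_itv/= => /andP[/ltW/subD v0 _].
      by have [] := dF v v0.
    + by apply: cvg_at_right_filter; apply: cF; rewrite invr_gt0.
    + by apply: cvg_at_left_filter; apply: cF; rewrite ltr0n.
  - move=> v; rewrite in_itv/= => /andP[/ltW/subD v0 _].
    by rewrite derive1E; have := dF v v0 => ?; rewrite derive_val.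
have := cvg_integral_exhaust_itv0y if_.
under eq_fun do rewrite FTC.
rewrite -(fineK (integrable_fin_num mD if_)) => /fine_cvg h.
apply: (cvg_unique _ h) => //.
have M0 : 0 <= M by apply: le_trans (@G_le 1 _) => //=; rewrite in_itv/= ltr01.
apply: norm_cvg0.
(* At the upper endpoint |F| <= C / v gives at most C / (n+1); at the lower one |F| <= M v^3 <= M v
   gives M / (n+1). *)
apply: (@squeeze_cvgr _ _ _ _ (cst 0) (fun n => (C + M) * harmonic n)).
- apply: nearW => n; rewrite normr_ge0/= (le_trans (ler_normB _ _))// mulrDl lerD//.
    rewrite (le_trans (F_le2 _ _))// ler_wpM2l// lef_pV2 ?posrE ?ltr0n// ler_nat//.
  rewrite (le_trans (F_le _ _)) ?invr_gt0// ler_wpM2l//.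
  by rewrite -[leRHS]expr1 ler_wiXn2l// ?invr_ge0// invf_le1 ?ler1n ?ltr0n.
- exact: cvg_cst.
- by rewrite -(mulr0 (C + M)); apply: cvgM; [exact: cvg_cst|exact: cvg_harmonic].
Qed.

(** With J_m the moments of [G], u' = J_0 - t^2 J_1 and u'' = t (t^2 J_2 - 3 J_1), which is the
    combination produced by the integration by parts. The formula for [u] is assumed for positive
    arguments only; derivatives being local, this suffices. *)
Lemma is_derive2_gauss_moment (u : R -> R) :
  (forall t, 0 < t -> u t = t * gauss_moment G 0 t) ->
  forall t, 0 < t -> [/\ derivable u t 1, derivable (derive1 u) t 1 &
    derive1 (derive1 u) t = t * gauss_moment H 0 t].
Proof.
move=> uE; pose J m := gauss_moment G m.
have dJ m t : 0 < t -> is_derive t 1 (J m) (- t * J m.+1 t).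
  exact: is_derive_gauss_moment mG G_le m t.
have du t : 0 < t -> is_derive t 1 u (J 0 t - t ^+ 2 * J 1 t).
  move=> t0; apply: (@near_eq_is_derive _ _ _ (fun t => t * J 0 t)).
  - by near=> s; rewrite uE//; near: s; exact: lt_nbhsr.
  - have dJt := dJ 0 t t0; apply: is_derive_eq.
    by rewrite /GRing.scale /=; ring.
have ddu t : 0 < t -> is_derive t 1 (derive1 u) (t * gauss_moment H 0 t).
  move=> t0; apply: (@near_eq_is_derive _ _ _ (fun t => J 0 t - t ^+ 2 * J 1 t)).
  - near=> s; rewrite derive1E; have /du ds : 0 < s by near: s; exact: lt_nbhsr.
    by rewrite derive_val.
  - have dJ0 := dJ 0 t t0; have dJ1 := dJ 1 t t0; apply: is_derive_eq.
    by rewrite gauss_moment_by_parts// /GRing.scale /= -/(J 1) -/(J 2); ring.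
move=> t t0; split; [by have [] := du t t0|by have [] := ddu t t0|].
by rewrite derive1E; have ? := ddu t t0; rewrite derive_val.
Unshelve. all: end_near. Qed.

End second_derivative.

(** * The forward equation *)

Section birth_process.
Context {R : realType} {d : measure_display} {T : measurableType d}.
Variables (P : probability T R) (lambda : nat -> R) (N : R -> T -> nat).
Hypothesis N_birth : pure_birth_process P lambda N.
Implicit Types (s t h : R) (k : nat).

Definition state_prob k t : R := fine (P [set w | N t w = k]).

Lemma measurable_state k t : 0 <= t -> measurable [set w | N t w = k].
Proof.
move=> t0; have := pb_measurable N_birth t0.
by move=> /(_ measurableT [set k] I); rewrite setTI.
Qed.

Lemma state_probE k t : 0 <= t -> P [set w | N t w = k] = (state_prob k t)%:E.
Proof.
by move=> t0; rewrite fineK// fin_num_measure//; exact: measurable_state.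
Qed.

Lemma state_prob_ge0 k t : 0 <= state_prob k t.
Proof. exact: fine_ge0. Qed.

Lemma state_prob_le1 k t : 0 <= t -> state_prob k t <= 1.
Proof.
move=> t0; rewrite -lee_fin -state_probE//.
by apply: probability_le1; exact: measurable_state.
Qed.

Lemma state_gt0 t w : 0 <= t -> (0 < N t w)%N.
Proof.
by move=> /(pb_nondecreasing N_birth w (lexx 0)); rewrite (pb_start N_birth).
Qed.

Lemma state_prob0 t : 0 <= t -> state_prob 0 t = 0.
Proof.
move=> t0; rewrite /state_prob (_ : [set w | _] = set0) ?measure0//.
by apply/seteqP; split => // w /= Nw; have := state_gt0 w t0; rewrite Nw.
Qed.

(** The sum stops at k because paths do not decrease: a chain in k at time t + h was in some i <= k
    at time t. The Markov property is used with the trivial past event. The term i = 0 is harmless,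
    although [q 0 k h] is unconstrained, because state 0 has probability 0. *)
Lemma state_prob_transition q k t h :
  (forall t h A i j, 0 <= t -> 0 <= h ->
    process_salgebra N [set u | 0 <= u <= t] A ->
    (1 <= i)%N -> (1 <= j)%N ->
    P (A `&` [set w | N t w = i] `&` [set w | N (t + h) w = j])
    = (P (A `&` [set w | N t w = i]) * (q i j h)%:E)%E) ->
  (1 <= k)%N -> 0 <= t -> 0 <= h ->
  state_prob k (t + h) = \sum_(i < k.+1) state_prob i t * q i k h.
Proof.
move=> markov k1 t0 h0.
have th0 : 0 <= t + h by rewrite addr_ge0.
pose A i := [set w | N t w = i] `&` [set w | N (t + h) w = k].
have mA i : measurable (A i) by apply: measurableI; exact: measurable_state.
have tA : trivIset setT A.
  by apply/trivIsetP => i j _ _ ij; apply/seteqP; split => // w /=;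
     rewrite /A /= => -[[-> _] [/eqP]]; rewrite (negbTE ij).
apply: EFin_inj; rewrite -state_probE//.
have -> : [set w | N (t + h) w = k] = \big[setU/set0]_(i < k.+1) A i.
  rewrite -bigcup_mkord; apply/seteqP; split => [w /= Nk|w [i _ []//]].
  exists (N t w); last by split.
  by rewrite /= ltnS -Nk; apply: (pb_nondecreasing N_birth); rewrite ?lerDl.
rewrite measure_bigsetU// -sumEFin; apply: eq_bigr => -[[|i] /= ik] _.
  rewrite state_prob0// mul0r (_ : A 0%N = set0) ?measure0//.
  apply/seteqP; split => // w /= [Nw _].
  by have := state_gt0 w t0; rewrite Nw.
rewrite EFinM -state_probE// -[in RHS](setTI [set w | N t w = i.+1]).
rewrite -markov// ?setTI//.
exact: (@measurableT _ (g_sigma_algebraType _)).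
Qed.

Lemma state_prob_increment : exists c : nat -> nat -> R -> R,
  (forall k t h, (1 <= k)%N -> 0 <= t -> 0 < h ->
    state_prob k (t + h) - state_prob k t =
    h * \sum_(i < k.+1) state_prob i t * c i k h) /\
  (forall i k, (1 <= k)%N ->
    c i k h @[h --> 0^'+] --> birth_generator lambda i k).
Proof.
have [q [_ markov gen]] := pb_markov N_birth.
(* Nothing is known about the transition function at i = 0; the generator value is a filler with the
   right limit, and its weight [state_prob 0 t] is 0. *)
exists (fun i k h => if i is 0%N then birth_generator lambda 0 k
                     else (q i k h - (i == k)%:R) / h).
split=> [k t h k1 t0 h0|[|i] k k1]; [|exact: cvg_cst|exact: gen].
rewrite (state_prob_transition markov)//; last exact: ltW.
have -> : state_prob k t = \sum_(i < k.+1) state_prob i t * (i == k :> nat)%:R.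
  rewrite big_ord_recr/= eqxx mulr1 big1 ?add0r// => i _.
  by rewrite (ltn_eqF (ltn_ord i)) mulr0.
rewrite -sumrB mulr_sumr; apply: eq_bigr => -[[|i] /= ik] _.
  by rewrite state_prob0// !mul0r mulr0 subr0.
by rewrite -mulrBr [RHS]mulrCA [h * _]mulrC divfK// gt_eqF.
Qed.

Lemma birth_generatorE k t : (1 <= k)%N -> 0 <= t ->
  \sum_(i < k.+1) state_prob i t * birth_generator lambda i k =
  lambda k.-1 * state_prob k.-1 t - lambda k * state_prob k t.
Proof.
case: k => // k _ t0; rewrite !big_ord_recr/= big1 ?add0r => [|i _].
  rewrite /birth_generator eqxx (gtn_eqF (ltnSn k)).
  by rewrite mulrN mulrC (mulrC (lambda k.+1)).
have ik := ltn_ord i.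
by rewrite /birth_generator !gtn_eqF ?mulr0// ltnS// ltnW.
Qed.

(** As probabilities are at most 1, the increment is bounded by h times the sum of the |c i k h|,
    which does not involve t and tends to 0. Uniformity in t yields left-continuity, and later the
    comparison of all grid cells at once. *)
Lemma state_prob_equicontinuous k e : (1 <= k)%N -> 0 < e ->
  \forall h \near 0^'+, forall t, 0 <= t ->
    `|state_prob k (t + h) - state_prob k t| <= e.
Proof.
move=> k1 e0; have [c [pc c_gen]] := state_prob_increment.
have : h * \sum_(i < k.+1) `|c i k h| @[h --> 0^'+] -->
    0 * \sum_(i < k.+1) `|birth_generator lambda i k|.
  apply: cvgM; first exact: cvg_at_right_filter.
  apply: cvg_big => [|i _]; first exact: add_continuous.
  by apply: cvg_norm; exact: c_gen.
rewrite mul0r => /cvgr0Pnorm_le/(_ e e0) he.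
near=> h => t t0; have h0 : 0 < h by near: h; exact: nbhs_right_gt.
rewrite pc// (@le_trans _ _ `|h * \sum_(i < k.+1) `|c i k h| |)//; last first.
  by near: h.
rewrite !normrM ler_wpM2l//.
rewrite [leRHS]ger0_norm ?sumr_ge0// (le_trans (ler_norm_sum _ _ _))//.
apply: ler_sum => i _; rewrite normrM ler_piMl//.
by rewrite ger0_norm ?state_prob_le1// state_prob_ge0.
Unshelve. all: end_near. Qed.

Lemma state_prob_continuous k t : 0 < t -> {for t, continuous (state_prob k)}.
Proof.
move=> t0; have [->|k0] := eqVneq k 0%N.
  apply: cvg_near_cst; near=> s.
  by rewrite !state_prob0// ltW//; near: s; exact: lt_nbhsr.
apply/cvgrPdist_le => e e0.
have := state_prob_equicontinuous (etrans (lt0n k) k0) e0.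
move=> [r /= r0 Hr]; near=> s.
have s0 : 0 < s by near: s; exact: lt_nbhsr.
have str : `|t - s| < r by near: s; exact: cvgr_dist_lt.
have [ts|st|<-] := ltgtP t s; last by rewrite subrr normr0 ltW.
- rewrite distrC -(subrKC t s); apply: Hr => /=; [|by rewrite subr_gt0|exact: ltW].
  by rewrite sub0r normrN distrC.
- rewrite -{1}(subrKC s t); apply: Hr => /=; [|by rewrite subr_gt0|exact: ltW].
  by rewrite sub0r normrN.
Unshelve. all: end_near. Qed.

(** The generator only gives right difference quotients. For the left derivative the increment is
    based at t - h, so its weights [state_prob i (t - h)] move with h; continuity of the state
    probabilities handles this. *)
Lemma is_derive_state_prob k t : (1 <= k)%N -> 0 < t ->
  is_derive t 1 (state_prob k)
    (lambda k.-1 * state_prob k.-1 t - lambda k * state_prob k t).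
Proof.
move=> k1 t0; have [c [pc c_gen]] := state_prob_increment.
rewrite -birth_generatorE ?ltW//.
set l := (X in is_derive _ _ _ X).
suff dl : h^-1 * (state_prob k (h + t) - state_prob k t) @[h --> 0^'] --> l.
  have dl' : h^-1 *: (state_prob k (h *: (1 : R^o) + t) - state_prob k t)
      @[h --> 0^'] --> (l : R^o).
    by under eq_fun do rewrite /GRing.scale /= mulr1.
  by apply: DeriveDef; [apply/cvg_ex; exists l|exact/cvg_lim].
apply: (@cvg_at_right_left_dnbhs _ R^o).
- apply: (@cvg_trans _ ((\sum_(i < k.+1) state_prob i t * c i k h) @[h --> 0^'+])).
    apply: near_eq_cvg; near=> h; have h0 : 0 < h by near: h; exact: nbhs_right_gt.
    rewrite (addrC h) pc ?ltW//.
    by rewrite mulKf// gt_eqF.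
  apply: cvg_big => [|i _]; first exact: add_continuous.
  by apply: cvgM; [exact: cvg_cst|exact: c_gen].
- have th : t - h @[h --> 0^'+] --> t.
    rewrite -[X in _ --> X](subr0 t); apply: cvgB; first exact: cvg_cst.
    exact: cvg_at_right_filter.
  apply/cvg_at_leftNP; rewrite oppr0.
  apply: (@cvg_trans _ ((\sum_(i < k.+1) state_prob i (t - h) * c i k h)
      @[h --> 0^'+])).
    apply: near_eq_cvg; near=> h; have h0 : 0 < h by near: h; exact: nbhs_right_gt.
    have ht : h < t by near: h; exact: nbhs_right_lt.
    rewrite /= (addrC (- h)) invrN mulNr -mulrN opprB.
    have -> : state_prob k t = state_prob k (t - h + h) by rewrite subrK.
    by rewrite pc// ?subr_ge0 ?ltW// mulKf// gt_eqF.
  apply: cvg_big => [|i _]; first exact: add_continuous.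
  apply: cvgM; last exact: c_gen.
  exact: (cvg_comp _ _ th (@state_prob_continuous i t t0)).
Unshelve. all: end_near. Qed.

End birth_process.

(** * Hitting events *)

Lemma process_salgebraS {R : realType} {d d' : measure_display}
    {T : measurableType d} {U : measurableType d'} (X : R -> T -> U)
    (I J : set R) :
  I `<=` J -> process_salgebra X I `<=` process_salgebra X J.
Proof. by move=> IJ; apply: sub_sigma_algebra2; exact: bigcup_subset. Qed.

Lemma process_salgebra_preimage {R : realType} {d d' : measure_display}
    {T : measurableType d} {U : measurableType d'} (X : R -> T -> U)
    (I : set R) (s : R) (Y : set U) :
  I s -> measurable Y -> process_salgebra X I (X s @^-1` Y).
Proof.
move=> Is mY; apply: sub_sigma_algebra; exists s => //.
by exists Y => //; rewrite setTI.
Qed.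

Lemma process_salgebra_measurable {R : realType} {d d' : measure_display}
    {T : measurableType d} {U : measurableType d'} (X : R -> T -> U)
    (I : set R) :
  (forall s, I s -> measurable_fun setT (X s)) ->
  process_salgebra X I `<=` measurable.
Proof.
move=> mX; apply: smallest_sub; first exact: sigma_algebra_measurable.
by move=> A [s Is [Y mY <-]]; exact: mX.
Qed.

(** Continuity from above along the tail unions [U n], whose intersection limsup C_n is contained in
    [A] by the last hypothesis. *)
Lemma measure_ge_limsup {d : measure_display} {T : measurableType d}
    {R : realType} (P : probability T R) (C : (set T)^nat) (A : set T)
    (c : \bar R) :
  (forall n, measurable (C n)) -> measurable A -> (forall n, (c <= P (C n))%E) ->
  (forall w, ~ A w -> \forall n \near \oo, ~ C n w) -> (c <= P A)%E.
Proof.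
move=> mC mA cC CA; pose U n := \bigcup_(m in [set m | (n <= m)%N]) C m.
have mU n : measurable (U n) by apply: bigcup_measurable.
have mcap : measurable (\bigcap_n U n) by apply: bigcap_measurable.
have Ucvg : (P \o U) n @[n --> \oo] --> P (\bigcap_n U n).
  apply: nonincreasing_cvg_mu => //.
    exact: (le_lt_trans (probability_le1 _ (mU 0%N)) (ltry 1)).
  by move=> m n mn; apply/subsetPset => w [k /= nk Ck]; exists k => //=;
     exact: leq_trans nk.
apply: (@le_trans _ _ (P (\bigcap_n U n))).
  rewrite -(cvg_lim _ Ucvg)//; apply: lime_ge.
    by apply/cvg_ex; eexists; exact: Ucvg.
  apply: nearW => n /=; apply: (le_trans (cC n)).
  by apply: le_measure; rewrite ?inE//; apply: bigcup_sup => /=.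
apply: le_measure; rewrite ?inE// => w Uw.
apply: contrapT => /CA[n _ Hn]; have [k /= nk Ck] := Uw n I.
exact: Hn Ck.
Qed.

Section hitting.
Context {R : realType} {d : measure_display} {T : measurableType d}.
Variables (P : probability T R) (B : R -> T -> R).
Hypothesis B_brownian : brownian_motion P B.
Implicit Types (a r s u x : R) (w : T).

(** For a > 0 this is the event T_a <= r; the inequality in place of an equality makes it accessible
    to rational times. *)
Definition hit a r : set T := [set w | exists2 u, 0 <= u <= r & a <= B u w].

(** Paths are constrained at nonnegative times only; freezing them at time 0 on the negative side
    gives functions continuous on all of R. *)
Let path w x := B (Num.max 0 x) w.

Let pathE w x : 0 <= x -> path w x = B x w.
Proof. by move=> x0; rewrite /path; congr (B _ w); exact/max_idPr. Qed.

Let path_continuous w : continuous (path w).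
Proof.
move=> x; have /subspace_continuousP cB := @bm_continuous _ _ _ _ _ B_brownian w.
pose y : R := Num.max 0 x.
have y0 : [set t | 0 <= t] y by rewrite /= le_max lexx.
have cy := cB y y0.
have mc : Num.max 0 z @[z --> x] --> y.
  exact: (@continuous_max _ _ (cst 0) id x (@cst_continuous _ _ _ _) cvg_id).
rewrite /continuous_at -/y.
apply: (@cvg_comp _ _ _ (Num.max 0) (B ^~ w) _ (within [set t | 0 <= t] (nbhs y))).
  move=> A /mc; apply: (@filterS _ (nbhs x)) => z /=; apply.
  by rewrite le_max lexx.
exact: cy.
Qed.

Lemma hit_le a r s : r <= s -> hit a r `<=` hit a s.
Proof.
by move=> rs w [u /andP[u0 ur] au]; exists u => //; rewrite u0 (le_trans ur).
Qed.

(** The maximum over [0, r] is attained, so the level is reached as soon as the path exceeds each a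
    - 1/(m+1) at some time in [0, r]; by continuity, rational times clamped to [0, r] by [cl]
    suffice. Membership in the past up to r, and not just measurability, is what independence of
    increments will require. *)
Lemma hit_salgebra a r : 0 <= r ->
  process_salgebra B [set u | 0 <= u <= r] (hit a r).
Proof.
move=> r0; pose cl x : R := Num.max 0 (Num.min x r).
have clr x : 0 <= cl x <= r by rewrite /cl le_max lexx/= ge_max r0 ge_min lexx orbT.
have -> : hit a r = \bigcap_m \bigcup_(q : rat)
    (B (cl (ratr q)) @^-1` `]a - m.+1%:R^-1, +oo[%classic).
  apply/seteqP; split => w.
    move=> [u /andP[u0 ur] au] m _.
    pose V := [set x | a - m.+1%:R^-1 < path w (Num.min x r)].
    have oV : open V.
      rewrite (_ : V = (path w \o Num.min^~ r) @^-1` [set y | a - m.+1%:R^-1 < y])//.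
      apply: open_comp; last exact: open_gt.
      move=> x _; apply: continuous_comp; last exact: path_continuous.
      exact: (@continuous_min _ _ id (cst r) x cvg_id (@cst_continuous _ _ _ _)).
    have uV : V u.
      rewrite /V /= (min_idPl ur) pathE//; apply: lt_le_trans au.
      by rewrite ltrBlDr ltrDl invr_gt0.
    have [x [Vx [q _ qx]]] := dense_rat (ex_intro _ u uV) oV.
    by exists q => //=; rewrite in_itv/= andbT /cl qx; exact: Vx.
  move=> Hw; have [c c0r maxc] :=
    EVT_max r0 (continuous_subspaceT (@path_continuous w)).
  have /andP[c0 cr] : 0 <= c <= r by move: c0r; rewrite in_itv.
  exists c; first by rewrite c0.
  rewrite -(pathE w c0); apply/ler_addgt0Pr => e e0.
  have [m me] : exists m, m.+1%:R^-1 < e.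
    have /filter_ex[m] := near_infty_natSinv_lt (PosNum e0).
    by exists m.
  have [q _ /=] := Hw m I; rewrite in_itv/= andbT ltrBlDr => /ltW.
  move/le_trans; apply; apply: lerD; last exact: ltW.
  have /andP[q0 qr] := clr (ratr q).
  by rewrite -(pathE w q0); apply: maxc; rewrite in_itv/= q0.
apply: (@bigcap_measurable _ (g_sigma_algebraType _)) => // m _.
apply: (@bigcupT_measurable_rat _ (g_sigma_algebraType _)) => q.
by apply: process_salgebra_preimage; [exact: clr|exact: measurable_itv].
Qed.

Lemma measurable_hit a r : 0 <= r -> measurable (hit a r).
Proof.
move=> r0; apply: (process_salgebra_measurable _ (hit_salgebra a r0)).
by move=> s /andP[s0 _]; exact: (bm_measurable B_brownian).
Qed.

(** The times in [0, s] with path value at least a form a nonempty compact set; its least element x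
    is the hitting time. *)
Lemma hit_first a s w : 0 < a -> hit a s w -> exists x,
  [/\ 0 < x <= s, B x w = a, first_passage_time B a w = x%:E &
      forall r, hit a r w <-> x <= r].
Proof.
move=> a0 [u /andP[u0 us] au].
have b0 : path w 0 = 0 by rewrite pathE// (bm_start B_brownian).
pose S := [set x | a <= path w x] `&` `[0, s]%classic.
have cS : compact S.
  rewrite /S setIC; apply: compact_closedI; first exact: segment_compact.
  apply: (@preimage_closed _ _ (path w) [set y | a <= y]); last exact: closed_ge.
  by move=> x _; exact: path_continuous.
have S0 : S !=set0 by exists u; rewrite /S /= in_itv/= u0 us pathE.
have [] := @compact_EVT_min _ _ id S S0 cS.
  by apply: continuous_subspaceT => x; exact: cvg_id.
move=> x; rewrite inE => -[/= ax]; rewrite in_itv/= => /andP[x0 xs] xmin.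
have xle v : 0 <= v -> a <= B v w -> x <= v.
  move=> v0 av; have [vs|/ltW sv] := leP v s; last exact: le_trans xs sv.
  by apply: xmin; rewrite inE; split => /=; rewrite ?in_itv/= ?v0// pathE.
have bxa : path w x = a.
  (* The path starts at 0 < a, so the value a is taken at some c <= x, and minimality of x forces c
     = x. *)
  have [] := @IVT _ (path w) 0 x a x0 (continuous_subspaceT (@path_continuous w)).
    by rewrite b0 ge_min (ltW a0)/= le_max ax orbT.
  move=> c; rewrite in_itv/= => /andP[c0 cx] bc.
  suff -> : x = c by [].
  by apply/eqP; rewrite eq_le cx andbT xle// -pathE// bc.
exists x; split.
- rewrite xs andbT lt_neqAle x0 andbT; apply/eqP => x0'.
  by move: a0; rewrite -bxa -x0' b0 ltxx.
- by rewrite -pathE.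
- apply/eqP; rewrite eq_le; apply/andP; split.
    by apply: ereal_inf_lbound; exists x => //=; rewrite -pathE.
  apply: le_ereal_inf_tmp => _ [v [v0 Bv] <-]; rewrite lee_fin xle// Bv//.
- move=> r; split => [[v /andP[v0 vr] av]|xr].
    exact: le_trans (xle v v0 av) vr.
  by exists x; rewrite ?x0// -pathE// bxa.
Qed.

Lemma brownian_continuous w x : 0 < x -> {for x, continuous (B ^~ w)}.
Proof.
move=> x0; rewrite /prop_for /continuous_at -(pathE w (ltW x0)).
apply: cvg_trans (@path_continuous w x); apply: near_eq_cvg; near=> z.
by rewrite pathE// ltW//; near: z; exact: lt_nbhsr.
Unshelve. all: end_near. Qed.

(** The event that j h is the first grid time not before T_a, that is, (j-1) h < T_a <= j h. For j =
    0 it is empty when a > 0. *)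
Definition grid_hit a (h : R) : (set T)^nat := seqD (fun j => hit a (j%:R * h)).

Lemma hit_grid_homo a (h : R) : 0 <= h ->
  {homo (fun j => hit a (j%:R * h)) : n m / (n <= m)%N >-> (n <= m)%O}.
Proof.
move=> h0 n m nm; apply/subsetPset; apply: hit_le.
by rewrite ler_wpM2r// ler_nat.
Qed.

Lemma grid_hit_salgebra a (h : R) j : 0 <= h ->
  process_salgebra B [set u | 0 <= u <= j%:R * h] (grid_hit a h j).
Proof.
move=> h0; case: j => [|j]; first by apply: hit_salgebra; rewrite mul0r.
apply: (@measurableD _ (g_sigma_algebraType _)).
  by apply: hit_salgebra; rewrite mulr_ge0.
apply: (@process_salgebraS _ _ _ _ _ _ [set u | 0 <= u <= j%:R * h]).
  move=> u /= /andP[-> uj]; apply: (le_trans uj).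
  by rewrite ler_wpM2r// ler_nat.
by apply: hit_salgebra; rewrite mulr_ge0.
Qed.

Lemma measurable_grid_hit a (h : R) j : 0 <= h -> measurable (grid_hit a h j).
Proof.
move=> h0; apply: (process_salgebra_measurable _ (@grid_hit_salgebra a h j h0)).
by move=> s /andP[s0 _]; exact: (bm_measurable B_brownian).
Qed.

Lemma grid_hit_first a (h : R) j w : 0 < a -> 0 <= h -> grid_hit a h j w ->
  exists x, [/\ 0 < x, j%:R * h - h < x <= j%:R * h, B x w = a &
    first_passage_time B a w = x%:E].
Proof.
move=> a0 h0; rewrite /grid_hit; case: j => [|j] /=.
  move=> /(hit_first a0) [x [/andP[x0 xh] _ _ _]].
  by move: x0; rewrite ltNge mul0r in xh *; rewrite xh.
move=> [/(hit_first a0)[x [/andP[x0 xh] Bx Tx xP]] nh].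
exists x; split => //; rewrite xh andbT -natr1 mulrDl mul1r addrK ltNge.
by apply/negP => /xP.
Qed.

End hitting.

(** * The reflection principle *)

Lemma normal_prob_set1 {R : realType} (m s x : R) : normal_prob m s [set x] = 0%E.
Proof. exact: integral_set1. Qed.

Lemma normal_prob_ge0_half {R : realType} (s : R) : 0 < s ->
  normal_prob 0 s `[0, +oo[%classic = (2^-1)%:E.
Proof.
move=> s0; have : normal_prob 0 s setT = 1%E by exact: probability_setT.
have mf : continuous (normal_pdf 0 s) by apply: continuous_normal_pdf; rewrite gt_eqF.
rewrite /normal_prob ge0_symfun_integralT//; last 2 first.
- by move=> x; exact: normal_pdf_ge0.
- by move=> x /=; rewrite normal_pdfE ?gt_eqF// /normal_fun !subr0 sqrrN.
rewrite -set_itvcy -/(normal_prob 0 s _) => E.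
have : normal_prob 0 s `[0, +oo[%classic \is a fin_num by exact: fin_num_measure.
move: E; case: (normal_prob _ _ _) => // r; rewrite -EFinM => -[E] _.
by congr (_%:E); lra.
Qed.

Lemma normal_prob_le0_half {R : realType} (s : R) : 0 < s ->
  normal_prob 0 s `]-oo, 0]%classic = (2^-1)%:E.
Proof.
move=> s0.
rewrite -(@setUitv1 _ R -oo%O 0 true) ?bnd_simp// measureU//; last first.
  by apply/seteqP; split => // x /=; rewrite in_itv/= => -[/[swap] ->]; rewrite ltxx.
rewrite [X in (_ + X)%E](normal_prob_set1 0 s 0) adde0 -setCitvr.
transitivity (1 - normal_prob 0 s `[0%R, +oo[%classic)%E.
  exact: (@probability_setC _ _ _ (normal_prob 0 s)).
rewrite (normal_prob_ge0_half s0) -EFinB.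
by congr (_%:E); lra.
Qed.

Section reflection.
Context {R : realType} {d : measure_display} {T : measurableType d}.
Variables (P : probability T R) (B : R -> T -> R).
Hypothesis B_brownian : brownian_motion P B.
Implicit Types (a r s u x : R) (w : T) (Y : set R).

Lemma measurable_increment r s Y : 0 <= r -> r <= s -> measurable Y ->
  measurable [set w | Y (B s w - B r w)].
Proof.
move=> r0 rs mY; rewrite -[X in measurable X]setTI.
apply: (measurable_funB (bm_measurable B_brownian (le_trans r0 rs))
  (bm_measurable B_brownian r0)) => //.
Qed.

(** An inequality, because at r = s the increment is 0 and lies in [Y] surely; this case occurs at
    the last grid time. *)
Lemma increment_ge_half r s Y : measurable Y -> Y 0 ->
  (forall c, 0 < c -> normal_prob 0 c Y = (2^-1)%:E) -> 0 <= r -> r <= s ->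
  ((2^-1)%:E <= P [set w | Y (B s w - B r w)%R])%E.
Proof.
move=> mY Y0 Yhalf r0; rewrite le_eqVlt => /predU1P[<-|rs].
  rewrite (_ : [set w | _] = setT) ?probability_setT ?lee_fin ?invf_le1 ?ler1n//.
  by apply/seteqP; split => // w _ /=; rewrite subrr.
have -> := bm_normal_increments B_brownian r0 rs mY.
by rewrite Yhalf// sqrtr_gt0 subr_gt0.
Qed.

(* Levy's argument: at the first grid time after the hitting time, the
   remaining increment is independent of the past and lies in [Y] with
   probability at least 1/2; letting the mesh tend to 0, that grid time tends
   to the hitting time, where the path equals [a]. *)
Lemma hit_increment_half a s Y : 0 < a -> 0 < s -> closed Y -> Y 0 ->
  (forall c, 0 < c -> normal_prob 0 c Y = (2^-1)%:E) ->
  ((2^-1)%:E * P (hit B a s) <= P (hit B a s `&` [set w | Y (B s w - a)%R]))%E.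
Proof.
move=> a0 s0 cY Y0 Yhalf; have mY : measurable Y by exact: closed_measurable.
(* The mesh divides s, so that s is itself the grid point of index n+1 and the indices below [n.+2]
   exhaust [hit B a s]. *)
pose h n : R := s / n.+1%:R.
have h0 n : 0 <= h n by rewrite divr_ge0// ltW.
have hs n j : (j < n.+2)%N -> j%:R * h n <= s.
  move=> jn; rewrite /h mulrA ler_pdivrMr// mulrC ler_wpM2l ?ler_nat//.
  exact: ltW.
pose C n := \big[setU/set0]_(j < n.+2) (grid_hit B a (h n) j `&`
  [set w | Y (B s w - B (j%:R * h n) w)]).
have mI n j : (j < n.+2)%N -> measurable (grid_hit B a (h n) j `&`
    [set w | Y (B s w - B (j%:R * h n) w)]).
  move=> jn; apply: measurableI; first exact: measurable_grid_hit B_brownian _ _ _ _.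
  by apply: measurable_increment => //; [rewrite mulr_ge0|exact: hs].
have hitE n : hit B a s = \big[setU/set0]_(j < n.+2) grid_hit B a (h n) j.
  rewrite /grid_hit nondecreasing_bigsetU_seqD; last exact: hit_grid_homo.
  by rewrite /h mulrCA divff ?mulr1// pnatr_eq0.
apply: (@measure_ge_limsup _ _ _ P C).
- move=> n; apply: bigsetU_measurable => j _; exact: mI.
- apply: measurableI; first exact: (measurable_hit B_brownian _ (ltW s0)).
  rewrite (_ : [set w | _] = B s @^-1` [set y | Y (y - a)])//.
  rewrite -[X in measurable X]setTI; apply: (bm_measurable B_brownian (ltW s0)) => //.
  rewrite (_ : [set y | _] = (fun y : R => y - a) @^-1` Y)//.
  rewrite -[X in measurable X]setTI.
  by apply: (@measurable_funB _ _ _ _ id (cst a)).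
- move=> n; have mG j : measurable (grid_hit B a (h n) j).
    exact: (measurable_grid_hit B_brownian).
  have tG : trivIset setT (grid_hit B a (h n)).
    by apply: trivIset_seqD; exact: hit_grid_homo.
  (* Additivity is applied to an infinite sequence of measurable sets, while increments up to s make
     sense only for grid times up to s; hence the truncation. *)
  pose D j := if (j < n.+2)%N then grid_hit B a (h n) j `&`
    [set w | Y (B s w - B (j%:R * h n) w)] else set0.
  have CE : C n = \big[setU/set0]_(j < n.+2) D j.
    by apply: eq_bigr => j _; rewrite /D ltn_ord.
  have mD j : measurable (D j) by rewrite /D; case: ifPn => // /mI.
  have tD : trivIset setT D.
    move=> i j _ _ [w []]; rewrite /D; case: ifPn => // _ [gi _].
    by case: ifPn => // _ [gj _]; apply: tG => //; exists w.
  rewrite (hitE n) CE !measure_bigsetU// ge0_sume_distrr//.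
  apply: lee_sum => j _; rewrite /D ltn_ord.
  have jh : j%:R * h n <= s by apply: hs.
  have jh0 : 0 <= j%:R * h n by rewrite mulr_ge0.
  have Pj : P (grid_hit B a (h n) j `&` [set w | Y (B s w - B (j%:R * h n) w)%R])
      = (P (grid_hit B a (h n) j) * P [set w | Y (B s w - B (j%:R * h n) w)%R])%E.
    apply: (bm_independent_increments B_brownian jh0 jh).
      exact: (grid_hit_salgebra B_brownian).
    by exists Y => //; rewrite setTI.
  apply: (@le_trans _ _ (P (grid_hit B a (h n) j) *
    P [set w | Y (B s w - B (j%:R * h n) w)%R])%E); last by rewrite -Pj.
  by rewrite muleC lee_wpmul2l// increment_ge_half.
- have CU n : C n = \bigcup_(j < n.+2) (grid_hit B a (h n) j `&`
      [set w | Y (B s w - B (j%:R * h n) w)]) by rewrite bigcup_mkord.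
  move=> w /=.
  have [hw|nhw] := pselect (hit B a s w); last first.
    move=> _; apply: nearW => n Cw; apply: nhw; rewrite (hitE n).
    move: Cw; rewrite CU -bigcup_mkord => -[j jn [gj _]].
    by exists j.
  have [x [/andP[x0 xs] Bx Tx _]] := hit_first B_brownian a0 hw.
  move=> nY; have {nY} : ~ Y (B s w - B x w) by rewrite Bx; apply: contra_not nY.
  (* Closedness of [Y] enters here: if the increment from the hitting time x avoids [Y], so do those
     from all times close to x, in particular from the grid time just after x once the mesh is
     small. *)
  move=> nY; have oYC := closed_openC cY.
  have cB : (fun u => B s w - B u w) @ x --> B s w - B x w.
    by apply: cvgB; [exact: cvg_cst|exact: (@brownian_continuous _ _ _ _ _ B_brownian w x x0)].
  have [e /= e0 He] := cB _ (open_nbhs_nbhs (conj oYC nY)).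
  near=> n; rewrite CU => -[j _ [gj Yj]].
  apply: (He (j%:R * h n)) => //=.
  have [y [y0 /andP[y1 y2] _ Ty]] := grid_hit_first B_brownian a0 (h0 n) gj.
  have yx : y = x by move: Ty; rewrite Tx => -[].
  have hne : h n < e.
    rewrite /h mulrC -ltr_pdivlMr//.
    by near: n; exact: (near_infty_natSinv_lt (PosNum (divr_gt0 e0 s0))).
  rewrite -yx ler0_norm ?subr_le0// opprB.
  by move: y1 hne; set z := j%:R * h n; set z' := h n; lra.
Unshelve. all: end_near. Qed.

(** Levy's bound for the two half-lines gives P(H) / 2 <= P(B_s >= a) and P(H) / 2 <= P(H, B_s < a).
    The right-hand sides add up to P(H), because B_s >= a implies H, so both are equalities. *)
Lemma hit_reflection a s : 0 < a -> 0 < s ->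
  P (hit B a s) = (2%:E * normal_prob 0 (Num.sqrt s) `[a, +oo[%classic)%E.
Proof.
move=> a0 s0; set H := hit B a s.
have mH : measurable H := measurable_hit B_brownian a (ltW s0).
have mB := bm_measurable B_brownian (ltW s0).
pose G := [set w | a <= B s w]; pose L := [set w | B s w < a].
have mG : measurable G.
  rewrite (_ : G = B s @^-1` `[a, +oo[%classic).
    by rewrite -[X in measurable X]setTI; exact: mB.
  by apply/seteqP; split => w; rewrite /G /= in_itv/= andbT.
have LG : L = ~` G by apply/seteqP; split => w; rewrite /L /G /= ltNge => /negP.
have mL : measurable L by rewrite LG; exact: measurableC.
have PY Y : measurable Y -> P [set w | Y (B s w)] = normal_prob 0 (Num.sqrt s) Y.
  move=> mY; rewrite -[X in Num.sqrt X](subr0 s).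
  rewrite -(bm_normal_increments B_brownian (lexx 0) s0 mY); congr (P _).
  by apply/seteqP; split => w /=; rewrite (bm_start B_brownian) subr0.
have HG : H `&` G = G.
  by apply/setIidPr => w Gw; exists s => //; rewrite lexx (ltW s0).
have PG : P G = normal_prob 0 (Num.sqrt s) `[a, +oo[%classic.
  rewrite -PY//; congr (P _).
  by apply/seteqP; split => w; rewrite /G /= in_itv/= andbT.
have half1 : ((2^-1)%:E * P H <= P G)%E.
  rewrite -HG -/H (_ : G = [set w | `[0, +oo[%classic (B s w - a)]).
    apply: hit_increment_half => //; [|by rewrite /= in_itv/= lexx|].
      exact: interval_closed.
    by move=> c; exact: normal_prob_ge0_half.
  by apply/seteqP; split => w; rewrite /G /= in_itv/= andbT subr_ge0.
have half2 : ((2^-1)%:E * P H <= P (H `&` L))%E.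
  have : ((2^-1)%:E * P H <= P (H `&` [set w | `]-oo, 0%R]%classic (B s w - a)%R]))%E.
    apply: hit_increment_half => //; first by rewrite /= in_itv/= lexx.
    by move=> c; exact: normal_prob_le0_half.
  (* The closed half-line contains 0, so the bound is for B_s <= a; the excess event B_s = a is
     null. *)
  have mA : measurable [set w | [set a] (B s w)].
    by rewrite -[X in measurable X]setTI; exact: (mB measurableT [set a]).
  rewrite (_ : [set w | _] = L `|` [set w | [set a] (B s w)]); last first.
    apply/seteqP; split => w /=; rewrite in_itv/= subr_le0 le_eqVlt.
      by move=> /predU1P[Ba|Ba]; [right|left].
    by move=> [Ba|->]; rewrite ?eqxx// (Ba : _ < a) orbT.
  rewrite setIUr => /le_trans; apply.
  have mHL : measurable (H `&` L) by exact: measurableI.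
  have mHA : measurable (H `&` [set w | [set a] (B s w)]) by exact: measurableI.
  have HA0 : (P (H `&` [set w | [set a] (B s w)]) <= 0)%E.
    rewrite -(normal_prob_set1 0 (Num.sqrt s) a) -PY//.
    by apply: le_measure; rewrite ?inE//; exact: subIsetr.
  apply: (le_trans (measureU2 P mHL mHA)).
  by rewrite -[leRHS]adde0; apply: leeD.
have PH : P H = (P G + P (H `&` L))%E.
  by rewrite (measureDI _ mH mG) HG addeC LG setDE.
have fin A : measurable A -> P A = (fine (P A))%:E.
  by move=> mA; rewrite fineK// fin_num_measure.
have mHL : measurable (H `&` L) by exact: measurableI.
rewrite -PG; move: half1 half2 PH; rewrite (fin _ mH) (fin _ mG) (fin _ mHL).
by rewrite -!EFinM -EFinD !lee_fin => ? ? [?]; congr (_%:E); lra.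
Qed.

End reflection.

(** * The law of the hitting time *)

(** Dominated convergence for indicators. Measurability of [A], a limsup of the [C n], is part of
    the conclusion, as it is not known beforehand for the event at the hitting time. *)
Lemma measure_cvg_eventually {d : measure_display} {T : measurableType d}
    {R : realType} (P : probability T R) (C : (set T)^nat) (A : set T) :
  (forall n, measurable (C n)) -> (forall w, \forall n \near \oo, C n w <-> A w) ->
  measurable A /\ P (C n) @[n --> \oo] --> P A.
Proof.
move=> mC CA; have mA : measurable A.
  rewrite (_ : A = \bigcap_n \bigcup_(m in [set m | (n <= m)%N]) C m).
    by apply: bigcap_measurable => // n _; apply: bigcup_measurable.
  apply/seteqP; split => w.
    move=> Aw n _; have [m _ Hm] := CA w; exists (maxn n m).
      exact: leq_maxl.
    by apply/(Hm (maxn n m)) => //=; exact: leq_maxr.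
  move=> Uw; have [n _ Hn] := CA w; have [m /= nm Cm] := Uw n I.
  exact/(Hn m).
split => //.
have PE D : measurable D -> P D = (\int[P]_w (\1_D w)%:E)%E.
  by move=> mD; rewrite integral_indic// setIT.
under eq_fun do rewrite PE//; rewrite PE//.
apply: (@dominated_cvg _ _ _ P setT _ _ _ (cst 1%E)) => //.
- by move=> n; apply/measurable_EFinP; exact: measurable_indic.
- move=> w _; apply: cvg_near_cst; apply: filterS (CA w) => n CAw.
  have CwA : (w \in C n) = (w \in A) by apply/idP/idP; rewrite !inE => /CAw.
  by rewrite !indicE CwA.
- exact: finite_measure_integrable_cst.
- by move=> n w _; rewrite /= lee_fin indicE; case: (_ \in _); rewrite ?normr1 ?normr0.
Qed.

Section hitting_time_law.
Context {R : realType}.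
Local Notation mu := (@lebesgue_measure R).
Implicit Types (a s r v : R).

(** Both sides are P(Z >= a / sqrt s) for a standard normal Z. On the right the level a is in the
    law and the time s only in the event, so the law of 1/v^2 can be read off for all s at once. *)
Lemma normal_prob_scale a s : 0 < a -> 0 < s ->
  normal_prob 0 (Num.sqrt s) `[a, +oo[%classic =
  normal_prob 0 a^-1 `[(Num.sqrt s)^-1, +oo[%classic.
Proof.
move=> a0 s0; set q := Num.sqrt s.
have q0 : 0 < q by rewrite sqrtr_gt0.
pose f v : R := a * q * v.
have df v : is_derive v 1 f (a * q).
  by rewrite /f; apply: is_derive_eq; rewrite /GRing.scale /=; ring.
have f'E : derive1 f = cst (a * q).
  by apply/funext => v; rewrite derive1E derive_val.
have Gq x : normal_pdf 0 q x = q^-1 * normal_peak 1 * gauss_kernel q^-1 x.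
  by rewrite -{1}(invrK q) normal_pdf_gauss_kernel ?invr_gt0.
have fa : f q^-1 = a by rewrite /f mulfK// gt_eqF.
rewrite /normal_prob -[in LHS]fa increasing_ge0_integration_by_substitutiony.
- apply: eq_integral => v _; congr (_%:E).
  rewrite f'E !fctE /= /f Gq normal_pdf_gauss_kernel//.
  rewrite (_ : gauss_kernel q^-1 (a * q * v) = gauss_kernel a v).
    by field; rewrite gt_eqF.
  by rewrite /gauss_kernel; congr expR; field; rewrite gt_eqF.
- by move=> x y _ _ xy; rewrite /f ltr_pM2l// mulr_gt0.
- by rewrite f'E => ? _; exact: cvg_cst.
- by rewrite f'E; exact: is_cvg_cst.
- by rewrite f'E; exact: is_cvg_cst.
- split; first by move=> v _; have [] := df v.
  apply: cvg_at_right_filter; apply: differentiable_continuous.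
  by apply/derivable1_diffP; have [] := df q^-1.
- by apply: gt0_cvgMry; [exact: mulr_gt0|exact: cvg_id].
- apply: continuous_subspaceT; apply: continuous_normal_pdf.
  by rewrite gt_eqF.
- by move=> v _; exact: normal_pdf_ge0.
Qed.

(** The condition T <= r under T = 1/v^2. Positivity of v excludes v = 0, whose inverse is 0 by
    convention, and keeps one half of a symmetric law; this is the origin of the factor 2 in the law
    of T. *)
Definition time_le r : set R := [set v | 0 < v /\ v ^- 2 <= r].

Lemma time_leE r : 0 < r -> time_le r = `[(Num.sqrt r)^-1, +oo[%classic.
Proof.
move=> r0; have q0 : 0 < Num.sqrt r by rewrite sqrtr_gt0.
apply/seteqP; split => v; rewrite /time_le /= in_itv/= andbT.
  move=> [v0 vr]; rewrite invf_ple ?posrE// -[leLHS]gtr0_norm ?invr_gt0//.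
  by rewrite -sqrtr_sqr ler_wsqrtr// exprVn.
move=> qv; have v0 : 0 < v by apply: lt_le_trans qv; rewrite invr_gt0.
split => //; move: qv; rewrite invf_ple ?posrE// => vq.
rewrite -exprVn -[leRHS](sqr_sqrtr (ltW r0)).
by apply: lerXn2r; rewrite ?nnegrE ?invr_ge0 ?sqrtr_ge0// ltW.
Qed.

Lemma time_le0 : time_le 0 = set0.
Proof.
apply/seteqP; split => // v [v0]; rewrite leNgt => /negP; apply.
by rewrite invr_gt0 exprn_gt0.
Qed.

Lemma measurable_time_le r : 0 <= r -> measurable (time_le r).
Proof.
rewrite le_eqVlt => /predU1P[<-|r0]; first by rewrite time_le0.
by rewrite time_leE.
Qed.

Lemma hit_prob {d : measure_display} {T : measurableType d}
    (P : probability T R) (B : R -> T -> R) a r :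
  brownian_motion P B -> 0 < a -> 0 <= r ->
  P (hit B a r) = (2%:E * normal_prob 0 a^-1 (time_le r))%E.
Proof.
move=> bB a0; rewrite le_eqVlt => /predU1P[<-|r0].
  rewrite time_le0 measure0 mule0 (_ : hit B a 0 = set0) ?measure0//.
  apply/seteqP; split => // w /(hit_first bB a0)[x [/andP[x0 x1] _ _ _]].
  by move: x0; rewrite ltNge x1.
by rewrite (hit_reflection bB a0 r0) (normal_prob_scale a0 r0) (time_leE r0).
Qed.

End hitting_time_law.

(** * The birth process at the hitting time *)

Section subordinated_birth.
Context {R : realType} {d : measure_display} {T : measurableType d}.
Variables (P : probability T R) (lambda : nat -> R) (N : R -> T -> nat).
Variables (B : R -> T -> R).
Hypothesis N_birth : pure_birth_process P lambda N.
Hypothesis B_brownian : brownian_motion P B.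
Hypothesis NB_independent : independent_processes P N B.
Local Notation mu := (@lebesgue_measure R).
Local Notation D := (`]0, +oo[%classic : set R).
Implicit Types (t v : R) (k n j : nat).

Definition state_at_hit k t : set T :=
  [set w | exists2 s : R, first_passage_time B t w = s%:E & N s w = k].

(** [N] is read at the hitting time rounded up to the grid: up, so that right-continuity of [N]
    suffices in the limit; to a grid, so that each piece is an event of [B] intersected with an
    event of [N]. *)
Definition state_at_grid_hit k t (h : R) : set T :=
  \bigcup_j (grid_hit B t h j `&` [set w | N (j%:R * h) w = k]).

Definition mesh n : R := n.+1%:R^-1.

Let mesh_gt0 n : 0 < mesh n. Proof. by rewrite invr_gt0. Qed.

Let gridE t h : 0 < t -> 0 < h ->
  \bigcup_j grid_hit B t h j = \bigcup_(s in [set s | 0 <= s]) hit B t s.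
Proof.
move=> t0 h0; rewrite eq_bigcup_seqD; apply/seteqP; split => w.
  by move=> [j _ Hj]; exists (j%:R * h) => //=; rewrite mulr_ge0// ltW.
move=> [s /= s0 Hs]; exists (Num.bound (s / h)) => //.
apply: hit_le Hs; rewrite -ler_pdivrMr// ltW//.
by apply: archi_boundP; rewrite divr_ge0// ltW.
Qed.

(** If the level is reached at x, then [N] is constant on some [x, x + e), which contains the
    rounded time once the mesh is below e. If it is never reached, both events fail. *)
Lemma state_at_grid_hit_cvg k t : 0 < t -> forall w,
  \forall n \near \oo, state_at_grid_hit k t (mesh n) w <-> state_at_hit k t w.
Proof.
move=> t0 w; have [[s s0 ws]|nhit] := pselect (exists2 s, 0 <= s & hit B t s w).
  have [x [/andP[x0 xs] Bx Tx _]] := hit_first B_brownian t0 ws.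
  have [e /= e0 He] := pb_right_continuous N_birth w (ltW x0).
  near=> n; have me : mesh n < e.
    by near: n; exact: (near_infty_natSinv_lt (PosNum e0)).
  have NE j : grid_hit B t (mesh n) j w -> N (j%:R * mesh n) w = N x w.
    move=> gj; have [y [y0 /andP[y1 y2] _ Ty]] :=
      grid_hit_first B_brownian t0 (ltW (mesh_gt0 n)) gj.
    have yx : y = x by move: Ty; rewrite Tx => -[].
    move: y1 y2; rewrite yx => y1; rewrite le_eqVlt => /predU1P[<-//|y2].
    apply: He => //=; rewrite ltr0_norm ?subr_lt0// opprB.
    by move: y1 me; set z := _ * _; lra.
  have [j _ gj] : (\bigcup_j grid_hit B t (mesh n) j) w.
    by rewrite gridE//; exists s.
  split => [[i _ [gi Nk]]|[y Ty Nk]].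
    by exists x => //; rewrite -(NE i).
  exists j => //; split => //=; rewrite NE// -Nk.
  by move: Ty; rewrite Tx => -[->].
apply: nearW => n; split => [[j _ [gj _]]|[x Tx _]]; exfalso; apply: nhit.
  have : (\bigcup_j grid_hit B t (mesh n) j) w by exists j.
  by rewrite gridE// => -[s /= s0 ws]; exists s.
have : [set s%:E | s in [set s : R | 0 <= s /\ B s w = t]] !=set0.
  apply/set0P/eqP => S0; move: Tx.
  by rewrite /first_passage_time S0 ereal_inf0.
move=> [_ [s [s0 Bs] _]]; exists s => //; exists s; rewrite ?s0 ?lexx//.
by rewrite Bs.
Unshelve. all: end_near. Qed.

Lemma measurable_state_at_grid_hit k t (h : R) : 0 <= h ->
  measurable (state_at_grid_hit k t h).
Proof.
move=> h0; apply: bigcupT_measurable => j; apply: measurableI.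
  exact: (measurable_grid_hit B_brownian).
by apply: (measurable_state N_birth); rewrite mulr_ge0.
Qed.

Definition time_grid (h : R) : nat -> set R := seqD (fun j => time_le (j%:R * h)).

Let time_le_homo (h : R) : 0 <= h ->
  {homo (fun j => time_le (j%:R * h)) : n m / (n <= m)%N >-> (n <= m)%O}.
Proof.
move=> h0 n m nm; apply/subsetPset => v [v0 vn]; split => //.
by apply: (le_trans vn); rewrite ler_wpM2r// ler_nat.
Qed.

Let measurable_time_grid (h : R) j : 0 <= h -> measurable (time_grid h j).
Proof.
move=> h0; case: j => [|j]; first by rewrite /time_grid /= mul0r time_le0.
by apply: measurableD; apply: measurable_time_le; rewrite mulr_ge0.
Qed.

Let time_grid_bigcup (h : R) : 0 < h -> \bigcup_j time_grid h j = D.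
Proof.
move=> h0; rewrite eq_bigcup_seqD; apply/seteqP; split => v.
  by move=> [j _ [v0 _]] /=; rewrite in_itv/= v0.
rewrite /= in_itv/= andbT => v0; exists (Num.bound (v ^- 2 / h)) => //.
split => //; rewrite -ler_pdivrMr// ltW//.
by apply: archi_boundP; rewrite divr_ge0 ?invr_ge0 ?exprn_ge0// ltW.
Qed.

Let time_grid_itv (h : R) j v : 0 <= h -> time_grid h j v ->
  0 < v /\ j%:R * h - h < v ^- 2 <= j%:R * h.
Proof.
move=> h0; rewrite /time_grid; case: j => [|j] /=; first by rewrite mul0r time_le0.
move=> [[v0 vj] nv]; split => //; rewrite vj andbT.
rewrite -natr1 mulrDl mul1r addrK ltNge; apply/negP => vj'.
by apply: nv; split.
Qed.

Let grid_hit_prob t (h : R) j : 0 < t -> 0 <= h ->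
  P (grid_hit B t h j) = (2%:E * normal_prob 0 t^-1 (time_grid h j))%E.
Proof.
move=> t0 h0; have jh0 i : 0 <= i%:R * h by rewrite mulr_ge0.
rewrite /grid_hit /time_grid; case: j => [|j] /=; first exact: hit_prob.
have mH i := measurable_hit B_brownian t (jh0 i).
have mW i := measurable_time_le (jh0 i).
have HS : hit B t (j%:R * h) `<=` hit B t (j.+1%:R * h).
  by apply: hit_le; rewrite ler_wpM2r// ler_nat.
have WS : time_le (j%:R * h) `<=` time_le (j.+1%:R * h).
  by apply/subsetPset; exact: (time_le_homo h0 (leqnSn j)).
have fH i : P (hit B t (i%:R * h)) \is a fin_num by exact: fin_num_measure.
have fW i : normal_prob 0 t^-1 (time_le (i%:R * h)) \is a fin_num.
  exact: (fin_num_measure (normal_prob 0 t^-1) _ (mW i)).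
have Wy i : (normal_prob 0 t^-1 (time_le (i%:R * h)) < +oo)%E by rewrite ltey_eq fW.
have -> : P (hit B t (j.+1%:R * h) `\` hit B t (j%:R * h)) =
    (P (hit B t (j.+1%:R * h)) - P (hit B t (j%:R * h)))%E.
  by rewrite measureD ?(setIidr HS)// ltey_eq fH.
have -> : normal_prob 0 t^-1 (time_le (j.+1%:R * h) `\` time_le (j%:R * h)) =
    (normal_prob 0 t^-1 (time_le (j.+1%:R * h)) -
     normal_prob 0 t^-1 (time_le (j%:R * h)))%E.
  rewrite [LHS]measureD ?(setIidr WS)//.
  all: try exact: mW. exact: Wy.
rewrite !(hit_prob B_brownian)//.
move: (fW j) (fW j.+1); case: (normal_prob _ _ _) => // x _.
case: (normal_prob _ _ _) => // y _.
by rewrite -[LHS]/((2 * y - 2 * x)%:E) -[RHS]/((2 * (y - x))%:E) mulrBr.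
Qed.

Let state_at_grid_hit_prob k t (h : R) : 0 < t -> 0 <= h ->
  P (state_at_grid_hit k t h) = (2%:E * \sum_(0 <= j <oo)
    (state_prob P N k (j%:R * h))%:E * normal_prob 0 t^-1 (time_grid h j))%E.
Proof.
move=> t0 h0; have jh0 i : 0 <= i%:R * h by rewrite mulr_ge0.
rewrite measure_semi_bigcup; last 3 first.
- move=> j; apply: measurableI; first exact: (measurable_grid_hit B_brownian).
  exact: (measurable_state N_birth).
- have tG : trivIset setT (grid_hit B t h).
    by apply: trivIset_seqD; exact: hit_grid_homo.
  by move=> i j _ _ [w [[gi _] [gj _]]]; apply: tG => //; exists w.
- exact: measurable_state_at_grid_hit.
rewrite -nneseriesZl; last first.
  by move=> j _; rewrite mule_ge0 ?lee_fin ?state_prob_ge0.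
apply: eq_eseriesr => j _.
transitivity (P [set w | N (j%:R * h) w = k] * P (grid_hit B t h j))%E.
  rewrite setIC; apply: NB_independent.
    exact: (@process_salgebra_preimage _ _ _ _ _ N _ _ [set k] (jh0 j)).
  apply: (process_salgebraS _ (@grid_hit_salgebra _ _ _ _ _ B_brownian t h j h0)).
  by move=> u /andP[].
by rewrite (grid_hit_prob _ t0 h0) (state_probE N_birth)// muleCA.
Qed.

Let inv_sqr_state k v : R := state_prob P N k (v ^- 2).

Let is_derive_inv_sqr v : 0 < v ->
  is_derive v 1 (fun v : R => v ^- 2) (- 2 / v ^+ 3).
Proof.
move=> v0; have v20 : v ^+ 2 != 0 by rewrite expf_neq0// gt_eqF.
apply: is_derive_eq; rewrite /GRing.scale /=; field.
by rewrite gt_eqF.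
Qed.

Let continuous_inv_sqr_state k : {in D, continuous (inv_sqr_state k)}.
Proof.
move=> v; rewrite inE/= in_itv/= andbT => v0.
apply: (@continuous_comp _ _ _ (fun v : R => v ^- 2) (state_prob P N k)).
  apply: differentiable_continuous; apply/derivable1_diffP.
  by have [] := is_derive_inv_sqr v0.
have v20 : 0 < v ^- 2 by rewrite invr_gt0 exprn_gt0.
exact: (@state_prob_continuous _ _ _ _ _ _ N_birth k _ v20).
Qed.

Let measurable_inv_sqr_state k : measurable_fun D (inv_sqr_state k).
Proof. exact: open_continuous_measurable_fun. Qed.

Let inv_sqr_state_ge0 k v : 0 <= inv_sqr_state k v.
Proof. exact: state_prob_ge0. Qed.

Let inv_sqr_state_le1 k v : D v -> `|inv_sqr_state k v| <= 1.
Proof.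
rewrite /= in_itv/= andbT => v0; rewrite ger0_norm//.
by apply: (state_prob_le1 N_birth); rewrite invr_ge0 exprn_ge0// ltW.
Qed.

Let mpdf t V : measurable_fun V (fun v => (normal_pdf 0 t^-1 v)%:E).
Proof. by apply/measurable_EFinP/measurable_funTS; exact: measurable_normal_pdf. Qed.

Let integral_cst_pdf t (c : R) (V : set (measurableTypeR R)) : 0 <= c -> measurable V ->
  (\int[mu]_(v in V) (c * normal_pdf 0 t^-1 v)%:E)%E =
  (c%:E * normal_prob 0 t^-1 V)%E.
Proof.
move=> c0 mV; under eq_integral do rewrite EFinM.
rewrite ge0_integralZl//; first exact: mpdf.
by move=> v _; rewrite lee_fin normal_pdf_ge0.
Qed.

Let state_mean k t : \bar R :=
  (\int[mu]_(v in D) (inv_sqr_state k v * normal_pdf 0 t^-1 v)%:E)%E.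

(** On the cell [time_grid h j] the time v^-2 lies within h below j h, so replacing one by the other
    in p_k costs at most e; the cells have total mass at most 1. *)
Let state_at_grid_hit_bounds k t (h e : R) : 0 < t -> 0 < h -> 0 < e ->
  (forall r s, 0 <= r <= h -> 0 <= s ->
    `|state_prob P N k (s + r) - state_prob P N k s| <= e) ->
  (P (state_at_grid_hit k t h) <= 2%:E * (state_mean k t + e%:E) /\
   2%:E * state_mean k t <= P (state_at_grid_hit k t h) + 2%:E * e%:E)%E.
Proof.
move=> t0 h0 e0 He; have jh0 j : 0 <= j%:R * h by rewrite mulr_ge0// ltW.
rewrite (state_at_grid_hit_prob k t0 (ltW h0)).
set q := fun j : nat => state_prob P N k (j%:R * h).
have q0 j : 0 <= q j by exact: state_prob_ge0.
have e0' := ltW e0; have h0' := ltW h0.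
pose V := time_grid h.
have mV j : measurable (V j : set (measurableTypeR R)) by exact: measurable_time_grid.
have VD : \bigcup_j V j = D by exact: time_grid_bigcup.
have VsubD j : V j `<=` D by rewrite -VD; exact: bigcup_sup.
have tV : trivIset setT V by apply: trivIset_seqD; exact: time_le_homo.
have qV j v : V j v -> `|q j - inv_sqr_state k v| <= e.
  move=> /(time_grid_itv h0')[v0 /andP[jv vj]].
  rewrite /q -(subrKC (v ^- 2) (j%:R * h)) /inv_sqr_state; apply: He.
    by rewrite subr_ge0 vj/=; move: jv; set z := _ * _; set y := v ^- 2; lra.
  by rewrite invr_ge0 exprn_ge0// ltW.
have mGp : measurable_fun D (fun v => (inv_sqr_state k v * normal_pdf 0 t^-1 v)%:E).
  apply/measurable_EFinP; apply: measurable_funM => //.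
  by apply: measurable_funTS; exact: measurable_normal_pdf.
have mGep : measurable_fun D
    (fun v => ((inv_sqr_state k v + e) * normal_pdf 0 t^-1 v)%:E).
  apply/measurable_EFinP; apply: measurable_funM.
    exact: measurable_funD.
  by apply: measurable_funTS; exact: measurable_normal_pdf.
have Gp_ge0 : forall v, D v -> (0 <= (inv_sqr_state k v * normal_pdf 0 t^-1 v)%:E)%E.
  by move=> v _; rewrite lee_fin mulr_ge0 ?normal_pdf_ge0.
have Gep_ge0 : forall v, D v ->
    (0 <= ((inv_sqr_state k v + e) * normal_pdf 0 t^-1 v)%:E)%E.
  by move=> v _; rewrite lee_fin mulr_ge0 ?normal_pdf_ge0 ?addr_ge0.
have nuD : (normal_prob 0 t^-1 D <= 1)%E.
  exact: (probability_le1 (normal_prob 0 t^-1)).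
have nuV j : (0 <= normal_prob 0 t^-1 (V j))%E.
  exact: (measure_ge0 (normal_prob 0 t^-1)).
have qnu j : (0 <= (q j)%:E * normal_prob 0 t^-1 (V j))%E.
  by apply: mule_ge0; [rewrite lee_fin|exact: nuV].
split.
- apply: lee_wpmul2l => //.
  apply: (@le_trans _ _ (\int[mu]_(v in D)
    ((inv_sqr_state k v + e) * normal_pdf 0 t^-1 v)%:E)%E).
    rewrite -[in leRHS]VD ge0_integral_bigcup ?VD//.
    apply: lee_nneseries => [j _ _|j _]; first exact: qnu.
    rewrite -(integral_cst_pdf t (q0 j) (mV j)); apply: ge0_le_integral => //.
    + by move=> v _; rewrite lee_fin mulr_ge0 ?normal_pdf_ge0.
    + apply/measurable_EFinP; apply: measurable_funM => //.
      by apply: measurable_funTS; exact: measurable_normal_pdf.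
    + by apply: measurable_funS mGep => //; exact: VsubD.
    + move=> v Vv; rewrite lee_fin ler_wpM2r ?normal_pdf_ge0//.
      by have := qV j v Vv; rewrite ler_norml => /andP[_]; rewrite lerBlDl.
  under eq_integral do rewrite mulrDl EFinD.
  rewrite ge0_integralD//; last 2 first.
  - by move=> v _; rewrite lee_fin mulr_ge0 ?normal_pdf_ge0.
  - apply/measurable_EFinP; apply: measurable_funM => //.
    by apply: measurable_funTS; exact: measurable_normal_pdf.
  rewrite (integral_cst_pdf t e0')// leeD2l//.
  by rewrite -[leRHS]mule1 lee_wpmul2l// lee_fin.
- rewrite -muleDr//; last first.
    rewrite ge0_adde_def// inE ?lee_fin// nneseries_ge0// => j _ _.
    exact: qnu.
  apply: lee_wpmul2l => //.
  apply: (@le_trans _ _ (\sum_(0 <= j <oo) ((q j)%:E * normal_prob 0 t^-1 (V j) +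
      e%:E * normal_prob 0 t^-1 (V j)))%E).
    rewrite /state_mean -[in leLHS]VD ge0_integral_bigcup ?VD//.
    apply: lee_nneseries => [j _ _|j _].
      by apply: integral_ge0 => v /VsubD; exact: Gp_ge0.
    rewrite -(integral_cst_pdf t (q0 j) (mV j)) -(integral_cst_pdf t e0' (mV j)).
    rewrite -ge0_integralD//; last 4 first.
    + by move=> v _; rewrite lee_fin mulr_ge0 ?normal_pdf_ge0.
    + apply/measurable_EFinP; apply: measurable_funM => //.
      by apply: measurable_funTS; exact: measurable_normal_pdf.
    + by move=> v _; rewrite lee_fin mulr_ge0 ?normal_pdf_ge0.
    + apply/measurable_EFinP; apply: measurable_funM => //.
      by apply: measurable_funTS; exact: measurable_normal_pdf.
    apply: ge0_le_integral => //.
    + by move=> v /VsubD; exact: Gp_ge0.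
    + by apply: measurable_funS mGp => //; exact: VsubD.
    + apply: emeasurable_funD; apply/measurable_EFinP; apply: measurable_funM => //;
      by apply: measurable_funTS; exact: measurable_normal_pdf.
    + move=> v Vv; rewrite -EFinD -mulrDl lee_fin ler_wpM2r ?normal_pdf_ge0//.
      by have := qV j v Vv; rewrite distrC ler_norml => /andP[_]; rewrite lerBlDl.
  rewrite nneseriesD; [|by move=> j _ _; exact: qnu|
    by move=> j _ _; apply: mule_ge0; [rewrite lee_fin|exact: nuV]].
  rewrite leeD2l// nneseriesZl//.
  rewrite -[leRHS]mule1 lee_wpmul2l ?lee_fin//.
  rewrite -(measure_semi_bigcup (normal_prob 0 t^-1))// ?VD//.
Qed.

Let state_mean_fin k t : state_mean k t = (\int[mu]_(v in D)
  (inv_sqr_state k v * normal_pdf 0 t^-1 v))%:E.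
Proof.
rewrite /Rintegral fineK// ge0_fin_numE; last first.
  by apply: integral_ge0 => v _; rewrite lee_fin mulr_ge0 ?normal_pdf_ge0.
have nuD : (normal_prob 0 t^-1 D <= 1)%E.
  exact: (probability_le1 (normal_prob 0 t^-1)).
apply: le_lt_trans (le_lt_trans nuD (ltry 1)).
apply: ge0_le_integral => //.
- by move=> v _; rewrite lee_fin mulr_ge0 ?normal_pdf_ge0.
- apply/measurable_EFinP; apply: measurable_funM.
    exact: measurable_inv_sqr_state.
  by apply: measurable_funTS; exact: measurable_normal_pdf.
- exact: mpdf.
- move=> v Dv; rewrite lee_fin ler_piMl ?normal_pdf_ge0//.
  by rewrite -(ger0_norm (inv_sqr_state_ge0 k v)) inv_sqr_state_le1.
Qed.

Let state_at_hit_prob k t : (1 <= k)%N -> 0 < t ->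
  P (state_at_hit k t) = (2%:E * state_mean k t)%E.
Proof.
move=> k1 t0; have [mA PA] := measure_cvg_eventually P
  (fun n => measurable_state_at_grid_hit k t (ltW (mesh_gt0 n)))
  (state_at_grid_hit_cvg k t0).
have bounds e : 0 < e -> \forall n \near \oo,
   (P (state_at_grid_hit k t (mesh n)) <= 2%:E * (state_mean k t + e%:E) /\
   2%:E * state_mean k t <= P (state_at_grid_hit k t (mesh n)) + 2%:E * e%:E)%E.
  move=> e0; have [r /= r0 Hr] := state_prob_equicontinuous N_birth k1 e0.
  near=> n; apply: state_at_grid_hit_bounds => // s u /andP[].
  rewrite le_eqVlt => /predU1P[<- _ _|s0 sn u0].
    by rewrite addr0 subrr normr0 ltW.
  apply: Hr => //=; rewrite sub0r normrN gtr0_norm// (le_lt_trans sn)//.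
  by near: n; exact: (near_infty_natSinv_lt (PosNum r0)).
have cPA : cvgn (fun n => P (state_at_grid_hit k t (mesh n))).
  by apply/cvg_ex; eexists; exact: PA.
rewrite state_mean_fin; set I := Rintegral _ _ _.
have fA : P (state_at_hit k t) = (fine (P (state_at_hit k t)))%:E.
  by rewrite fineK// fin_num_measure.
apply/eqP; rewrite eq_le; apply/andP; split; apply/lee_addgt0Pr => e e0.
- rewrite -(cvg_lim _ PA)//; apply: lime_le => //.
  have e2 : 0 < e / 2 by rewrite divr_gt0.
  apply: filterS (bounds _ e2) => n [+ _]; move/le_trans; apply.
  by rewrite state_mean_fin -EFinD -!EFinM -EFinD lee_fin -/I; lra.
- rewrite -leeBlDr// -(cvg_lim _ PA)//; apply: lime_ge => //.
  have e2 : 0 < e / 2 by rewrite divr_gt0.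
  apply: filterS (bounds _ e2) => n [_]; rewrite state_mean_fin -/I.
  by rewrite leeBlDr// -EFinM; move/le_trans; apply; rewrite leeD2l// lee_fin; lra.
Unshelve. all: end_near. Qed.

(** In the constant, 2 comes from the half-line v > 0, while t and [normal_peak 1] come from the
    density of standard deviation 1/t. For k = 0 both sides vanish since state 0 is never
    visited. *)
Lemma hat_pE k t : 0 < t -> hat_p P N B k t =
  t * gauss_moment (fun v => 2 * normal_peak 1 * state_prob P N k (v ^- 2)) 0 t.
Proof.
move=> t0; rewrite /gauss_moment; case: k => [|k].
  rewrite /= (_ : Rintegral _ _ _ = \int[mu]_(v in D) 0).
    by rewrite Rintegral_cst// mul0r mulr0.
  apply: eq_Rintegral => v; rewrite inE/= in_itv/= andbT => v0.
  by rewrite (state_prob0 N_birth) ?mulr0 ?mul0r// invr_ge0 exprn_ge0// ltW.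
rewrite /hat_p -/(state_at_hit k.+1 t) state_at_hit_prob// state_mean_fin.
rewrite -EFinM /=.
have iG := integrable_gauss_moment (measurable_inv_sqr_state k.+1)
  (@inv_sqr_state_le1 k.+1) 0 t0.
have mD : measurable (D : set (measurableTypeR R)) by [].
set J := \int[mu]_(v in D) (inv_sqr_state k.+1 v *
  (v ^+ 0.*2 * gauss_kernel t v)).
have -> : \int[mu]_(v in D) (inv_sqr_state k.+1 v * normal_pdf 0 t^-1 v) =
    t * normal_peak 1 * J.
  rewrite -(RintegralZl _ mD iG); apply: eq_Rintegral => v _.
  by rewrite normal_pdf_gauss_kernel//; ring.
have -> : \int[mu]_(v in D) (2 * normal_peak 1 * state_prob P N k.+1 (v ^- 2) *
    (v ^+ 0.*2 * gauss_kernel t v)) = 2 * normal_peak 1 * J.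
  rewrite -(RintegralZl _ mD iG); apply: eq_Rintegral => v _.
  by rewrite /inv_sqr_state mulrA.
ring.
Qed.

Lemma hat_p_ode k t : (1 <= k)%N -> 0 < t ->
  [/\ derivable (hat_p P N B k) t 1,
      derivable (derive1 (hat_p P N B k)) t 1 &
      derive1 (derive1 (hat_p P N B k)) t
      = 2 * (lambda k * hat_p P N B k t
             - lambda k.-1 * hat_p P N B k.-1 t)].
Proof.
move=> k1 t0; pose c : R := 2 * normal_peak 1.
pose G v := c * inv_sqr_state k v.
(* By the chain rule G' = c p_k'(v^-2) (-2 / v^3); the forward equation then makes [H], defined as
   v^3 G', this combination. *)
pose H v := 2 * lambda k * (c * inv_sqr_state k v) -
            2 * lambda k.-1 * (c * inv_sqr_state k.-1 v).
have mG i : measurable_fun D (fun v => c * inv_sqr_state i v).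
  exact: measurable_funM.
have c0 : 0 <= c by rewrite mulr_ge0 ?normal_peak_ge0.
have G_le i v : D v -> `|c * inv_sqr_state i v| <= c.
  move=> Dv; rewrite normrM ger0_norm// -[leRHS]mulr1 ler_wpM2l//.
  exact: inv_sqr_state_le1.
(* A common bound: the summand 1 serves [G], the other two serve the terms of [H]. *)
pose M := (1 + 2 * `|lambda k| + 2 * `|lambda k.-1|) * c.
have GM v : D v -> `|G v| <= M.
  move=> Dv; rewrite (le_trans (G_le k v Dv))// /M ler_peMl//.
  by rewrite -addrA lerDl addr_ge0// mulr_ge0.
have term_le i (l : R) v : D v ->
    `|2 * l * (c * inv_sqr_state i v)| <= 2 * `|l| * c.
  move=> Dv; rewrite normrM (normrM 2) (ger0_norm (ler0n R 2)).
  by apply: ler_wpM2l; [rewrite mulr_ge0|exact: G_le].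
have HM v : D v -> `|H v| <= M.
  move=> Dv; apply: (le_trans (ler_normB _ _)).
  have -> : M = c + (2 * `|lambda k| * c + 2 * `|lambda k.-1| * c).
    by rewrite /M; ring.
  by apply: ler_wpDl => //; apply: lerD; exact: term_le.
have G'E v : 0 < v -> is_derive v 1 G (H v / v ^+ 3).
  move=> v0; have v20 : 0 < v ^- 2 by rewrite invr_gt0 exprn_gt0.
  have d1 := is_derive_inv_sqr v0.
  have d2 := is_derive_state_prob N_birth k1 v20.
  have d3 := @is_derive1_comp _ (state_prob P N k) (fun v : R => v ^- 2)
    v _ _ d2 d1.
  have -> : G = c *: (state_prob P N k \o (fun v : R => v ^- 2)) by [].
  apply: is_derive_eq; rewrite /GRing.scale /= /H /inv_sqr_state.
  by field; rewrite gt_eqF.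
have cH : {in D, continuous H}.
  move=> v Dv; have cG := @continuous_inv_sqr_state _ v Dv.
  by apply: cvgB; apply: cvgM; try exact: cvg_cst; apply: cvgM;
    [exact: cvg_cst|exact: cG|exact: cvg_cst|exact: cG].
have uE s : 0 < s -> hat_p P N B k s = s * gauss_moment G 0 s.
  exact: hat_pE.
have [d1 d2 ->] := is_derive2_gauss_moment (mG k) GM G'E cH HM uE t0.
split => //; rewrite !hat_pE// /gauss_moment.
have iG i := integrable_gauss_moment (mG i) (@G_le i) 0 t0.
have iGZ i (a : R) : mu.-integrable D (EFin \o (fun v => a *
    (c * inv_sqr_state i v * (v ^+ 0.*2 * gauss_kernel t v)))).
  by apply: (integrableZl _ a (iG i)).
rewrite (_ : Rintegral _ _ _ = \int[mu]_(v in D)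
   (2 * lambda k * (c * inv_sqr_state k v * (v ^+ 0.*2 * gauss_kernel t v)) -
    2 * lambda k.-1 * (c * inv_sqr_state k.-1 v * (v ^+ 0.*2 * gauss_kernel t v)))).
  rewrite RintegralB// !RintegralZl//.
  by rewrite /inv_sqr_state; ring.
by apply: eq_Rintegral => v _; rewrite /H; ring.
Qed.

End subordinated_birth.

Theorem theorem2p3 (R : realType) (d : measure_display) (T : measurableType d)
    (P : probability T R) (lambda : nat -> R) (N : R -> T -> nat)
    (B : R -> T -> R)
    (lambda_gt0 : forall k, (1 <= k)%N -> 0 < lambda k)
    (no_explosion : (\sum_(1 <= k <oo) ((lambda k)^-1)%:E = +oo)%E)
    (N_birth : pure_birth_process P lambda N)
    (B_brownian : brownian_motion P B)
    (NB_independent : independent_processes P N B) :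
  forall (k : nat) (t : R), (1 <= k)%N -> 0 < t ->
    [/\ derivable (hat_p P N B k) t 1,
        derivable (derive1 (hat_p P N B k)) t 1 &
        derive1 (derive1 (hat_p P N B k)) t
        = 2 * (lambda k * hat_p P N B k t
               - lambda k.-1 * hat_p P N B k.-1 t)].
Proof. by move=> k t; exact: hat_p_ode. Qed.
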